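(* Let $d\ge1$. Let $F$ be a centered square-integrable random vector in $\mathbb R^d$ with a density and positive definite covariance matrix $B$, let $Z\sim\mathscr N_d(0,C)$ with $C$ positive definite, and assume $F$ and $Z$ are independent. Let $F_t=\sqrt t\,F+\sqrt{1-t}\,Z$ and $\Gamma_t=tB+(1-t)C$ for $t\in[0,1]$. Assume that $\tau_F$ is a Stein matrix for $F$ such that $\tau_F^{i,j}(F)\in L^1(\Omega)$ for every $i,j=1,\dots,d$. Then, for every $t\in[0,1)$, the mapping $$\mathbf x\mapsto-\frac{t}{\sqrt{1-t}}\,E\Big[\big(I_d-C^{-1}\tau_F(F)\big)C^{-1}Z\,\Big|\,F_t=\mathbf x\Big]-C^{-1}\mathbf x$$ is a version of the score $\rho_t$ of $F_t$. Also, the mapping $$\mathbf x\mapsto-\frac{t}{\sqrt{1-t}}\,E\Big[\big(\Gamma_t-\Gamma_tC^{-1}\tau_F(F)\big)C^{-1}Z\,\Big|\,F_t=\mathbf x\Big]-\Gamma_tC^{-1}\mathbf x$$ is a version of the function $\rho_t^\star:=\Gamma_t\rho_t$.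
   Context: A Stein matrix for $F$ is a matrix-valued map $\tau_F=\{\tau_F^{i,j}\}:\mathbb R^d\to M(d,\mathbb R)$ (the space of $d\times d$ real matrices) such that $\tau_F^{i,j}(F)\in L^1$ for all $i,j$ and $E[Fg(F)]=E[\tau_F(F)\nabla g(F)]$ for every differentiable $g:\mathbb R^d\to\mathbb R$ such that both sides are well defined (vectors are column vectors). For $t\in[0,1)$ the vector $F_t$ has a strictly positive infinitely differentiable density $f_t$, and its score is $\rho_t(\mathbf x)=\nabla\log f_t(\mathbf x)$; the random vector $\rho_t(F_t)$ is characterized, up to $P$-null sets, by $E[\rho_t(F_t)g(F_t)]=-E[\nabla g(F_t)]$ for every smooth $g:\mathbb R^d\to\mathbb R$. ''Version'' means equality almost everywhere (equivalently, almost surely when evaluated at $F_t$). $I_d$ is the identity matrix. *)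

(* Defs.v *)
From HB Require Import structures.
From mathcomp Require Import all_boot all_order all_algebra.
From mathcomp Require Import all_classical all_reals all_analysis.

Set Implicit Arguments.
Unset Strict Implicit.
Unset Printing Implicit Defensive.

Import Order.TTheory GRing.Theory Num.Theory.
Import numFieldNormedType.Exports.

Local Open Scope classical_set_scope.
Local Open Scope ring_scope.

(* The sigma-algebra on matrices generated by the entries; for real matrices it
   is the Borel sigma-algebra. *)

Definition measure_matrix_display : measure_display -> measure_display.
Proof. exact. Qed.

Section measurable_matrix.
Context {d} {T : sigmaRingType d} {m n : nat}.

Definition g_sigma_entries : set (set 'M[T]_(m, n)) :=
  <<s \bigcup_(ij in [set: 'I_m * 'I_n])
        preimage_set_system setT (fun M : 'M[T]_(m, n) => M ij.1 ij.2)
          measurable >>.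

Let matrix_set0 : g_sigma_entries set0.
Proof. exact: sigma_algebra0. Qed.

Let matrix_setC A : g_sigma_entries A -> g_sigma_entries (~` A).
Proof. exact: sigma_algebraC. Qed.

Let matrix_bigcup (F : _^nat) : (forall i, g_sigma_entries (F i)) ->
  g_sigma_entries (\bigcup_i (F i)).
Proof. exact: sigma_algebra_bigcup. Qed.

HB.instance Definition _ := @isMeasurable.Build (measure_matrix_display d)
  'M[T]_(m, n) g_sigma_entries matrix_set0 matrix_setC matrix_bigcup.

End measurable_matrix.

Lemma measurable_entry d (T : measurableType d) m n (i : 'I_m) (j : 'I_n) :
  measurable_fun [set: 'M[T]_(m, n)] (fun M : 'M[T]_(m, n) => M i j).
Proof.
move=> _ Y mY; rewrite setTI; apply: sub_sigma_algebra => /=.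
by exists (i, j) => //; exists Y => //; rewrite setTI.
Qed.

Lemma measurable_fun_matrixP d1 d2 (T1 : measurableType d1)
    (T2 : measurableType d2) m n (f : T1 -> 'M[T2]_(m, n)) :
  measurable_fun [set: T1] f <->
  forall i j, measurable_fun [set: T1] (fun x => f x i j).
Proof.
split=> [mf i j|mf].
  exact: (measurableT_comp (@measurable_entry _ _ _ _ i j) mf).
move=> _ Y mY; rewrite setTI.
suff : g_sigma_entries `<=` [set A | measurable (f @^-1` A)] by exact.
apply: smallest_sub.
  split=> [|A mA|A mA] /=.
  - by rewrite preimage_set0.
  - by rewrite setTD preimage_setC; exact: measurableC.
  - by rewrite preimage_bigcup; apply: bigcup_measurable => k _; exact: mA.
move=> _ [[i j] _ [B mB <-]] /=; rewrite setTI.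
by have := mf i j measurableT B mB; rewrite setTI.
Qed.

Section lebesgue_measure_cV.
Context {R : realType}.

Definition cons_cV {n} (p : measurableTypeR R * 'cV[R]_n) : 'cV[R]_n.+1 :=
  col_mx (const_mx p.1 : 'cV_1) p.2.

Lemma measurable_cons_cV n : measurable_fun setT (@cons_cV n).
Proof.
apply/measurable_fun_matrixP => i j.
rewrite /cons_cV; case: (@split_ordP 1 n i) => k ->.
  apply: (eq_measurable_fun fst) => [p _|]; last exact: measurable_fst.
  by rewrite [RHS](@col_mxEu R 1 n 1) mxE.
apply: (eq_measurable_fun (fun p : measurableTypeR R * 'cV[R]_n => p.2 k j)) => [p _|].
  by rewrite [RHS](@col_mxEd R 1 n 1).
exact: (measurableT_comp (@measurable_entry _ _ _ _ k j)).
Qed.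

Section step.
Local Open Scope ereal_scope.
Context n (mu : {sigma_finite_measure set 'cV[R]_n -> \bar R}).

Definition lebesgue_measure_step : set 'cV[R]_n.+1 -> \bar R :=
  pushforward (lebesgue_measure \x mu) cons_cV.

Let step0 : lebesgue_measure_step set0 = 0.
Proof. by rewrite /lebesgue_measure_step /pushforward preimage_set0 measure0. Qed.

Let step_ge0 A : 0 <= lebesgue_measure_step A.
Proof. by rewrite /lebesgue_measure_step /pushforward measure_ge0. Qed.

Let step_sigma_additive : semi_sigma_additive lebesgue_measure_step.
Proof.
have mc A : measurable A -> measurable (@cons_cV n @^-1` A).
  by move=> mA; rewrite -[X in measurable X]setTI; exact: measurable_cons_cV.
move=> F mF tF mUF; rewrite /lebesgue_measure_step /pushforward preimage_bigcup.
apply: measure_semi_sigma_additive => [k||].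
- exact: mc.
- apply/trivIsetP => /= i j _ _ ij; rewrite -preimage_setI.
  by move/trivIsetP : tF => /(_ _ _ _ _ ij) ->//; rewrite preimage_set0.
- by rewrite -preimage_bigcup; exact: mc.
Qed.

HB.instance Definition _ := isMeasure.Build _ _ _ lebesgue_measure_step
  step0 step_ge0 step_sigma_additive.

Let step_sigma_finite : sigma_finite setT lebesgue_measure_step.
Proof.
pose uncons (v : 'cV[R]_n.+1) : measurableTypeR R * 'cV[R]_n :=
  (v ord0 ord0, dsubmx (v : 'cV_(1 + n))).
have unconsK : cancel cons_cV uncons.
  move=> [x v]; rewrite /uncons /cons_cV; congr pair; last exact: col_mxKd.
  rewrite (_ : ord0 = lshift n (ord0 : 'I_1)); last exact/val_inj.
  by rewrite [LHS](@col_mxEu R 1 n 1) mxE.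
have muncons : measurable_fun setT uncons.
  apply/measurable_fun_pair; first exact: measurable_entry.
  apply/measurable_fun_matrixP => i j.
  apply: (eq_measurable_fun (fun v : 'cV[R]_(1 + n) => v (rshift 1 i) j)).
    by move=> v _; rewrite mxE.
  exact: measurable_entry.
have /sigma_finiteP[F [FT ndF Foo]] := sigma_finiteT (@lebesgue_measure R).
have /sigma_finiteP[G [GT ndG Goo]] := sigma_finiteT mu.
exists (fun k => uncons @^-1` (F k `*` G k)).
  rewrite -preimage_bigcup (_ : \bigcup_i _ = setT) ?preimage_setT//.
  apply/seteqP; split=> // -[x y] _.
  have [k _ Fx] : (\bigcup_k F k) x by rewrite -FT.
  have [l _ Gy] : (\bigcup_k G k) y by rewrite -GT.
  exists (maxn k l) => //; split.
  - by move: x Fx; exact/subsetPset/ndF/leq_maxl.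
  - by move: y Gy; exact/subsetPset/ndG/leq_maxr.
move=> k; have [mF Fk] := Foo k; have [mG Gk] := Goo k.
have mFG : measurable (F k `*` G k) by exact: measurableX.
split; first by rewrite -[X in measurable X]setTI; exact: muncons.
rewrite /lebesgue_measure_step /pushforward -comp_preimage.
rewrite (_ : uncons \o cons_cV = id); last exact/funext.
by rewrite preimage_id product_measure1E// lte_mul_pinfty// ge0_fin_numE.
Qed.

HB.instance Definition _ := Measure_isSigmaFinite.Build _ _ _
  lebesgue_measure_step step_sigma_finite.

End step.

(* The d-dimensional Lebesgue measure: the d-fold product of lebesgue_measure,
   transported to column vectors one coordinate at a time. *)
Fixpoint lebesgue_measure_cV n : {sigma_finite_measure set 'cV[R]_n -> \bar R} :=
  match n with
  | 0 => \d_(0 : 'cV[R]_0)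
  | n'.+1 => lebesgue_measure_step (lebesgue_measure_cV n')
  end.

End lebesgue_measure_cV.

Section calculus.
Context {R : realType} {d : nat}.

Definition partial (i : 'I_d) (f : 'cV[R]_d -> R) : 'cV[R]_d -> R :=
  'D_(delta_mx i ord0) f.

Definition gradient (f : 'cV[R]_d -> R) (x : 'cV[R]_d) : 'cV[R]_d :=
  \col_i partial i f x.

Fixpoint continuously_differentiable k (f : 'cV[R]_d -> R) : Prop :=
  match k with
  | 0 => continuous f
  | k'.+1 => (forall x, differentiable f x) /\
             (forall i, continuously_differentiable k' (partial i f))
  end.

Definition infinitely_differentiable (f : 'cV[R]_d -> R) :=
  forall k, continuously_differentiable k f.

Definition score (f : 'cV[R]_d -> R) : 'cV[R]_d -> 'cV[R]_d :=
  gradient (fun x => ln (f x)).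

Definition posdefmx (A : 'M[R]_d) :=
  A^T = A /\ forall x : 'cV[R]_d, x != 0 -> 0 < (x^T *m A *m x) ord0 ord0.

(* The density of N_d(0, C), for C positive definite. *)
Definition normal_pdf_cV (C : 'M[R]_d) (x : 'cV[R]_d) : R :=
  (Num.sqrt ((2 * pi) ^+ d * \det C))^-1 *
  expR (- (x^T *m invmx C *m x) ord0 ord0 / 2).

End calculus.

Section random_vectors.
Context {disp : measure_display} {T : measurableType disp} {R : realType}.
Variable P : probability T R.

Definition has_density {d} (X : T -> 'cV[R]_d) (f : 'cV[R]_d -> R) :=
  [/\ measurable_fun setT f,
      forall x, 0 <= f x &
      forall A, measurable A ->
        P (X @^-1` A) = (\int[lebesgue_measure_cV d]_(x in A) (f x)%:E)%E].

Definition independent_vectors {m n} (X : T -> 'cV[R]_m) (Y : T -> 'cV[R]_n) :=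
  forall A B, measurable A -> measurable B ->
    P (X @^-1` A `&` Y @^-1` B) = (P (X @^-1` A) * P (Y @^-1` B))%E.

Definition Lvector {d} (p : \bar R) (X : T -> 'cV[R]_d) :=
  forall i, (fun w => X w i ord0) \in Lfun P p.

Definition is_covariance_matrix {d} (X : T -> 'cV[R]_d) (B : 'M[R]_d) :=
  forall i j,
    covariance P (fun w => X w i ord0) (fun w => X w j ord0) = (B i j)%:E.

(* h is a version of x |-> E[Y | X = x]. *)
Definition is_condexp {m n} (Y : T -> 'cV[R]_n) (X : T -> 'cV[R]_m)
    (h : 'cV[R]_m -> 'cV[R]_n) :=
  [/\ Lvector 1 Y, measurable_fun setT h, Lvector 1 (h \o X) &
      forall A, measurable A -> forall i,
        (\int[P]_(w in X @^-1` A) (h (X w) i ord0)%:E =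
         \int[P]_(w in X @^-1` A) (Y w i ord0)%:E)%E].

(* The expectations are taken entrywise; "both sides are well defined" is read as
   integrability of all the entries of both vectors. *)
Definition is_Stein_matrix {d} (X : T -> 'cV[R]_d)
    (tau : 'cV[R]_d -> 'M[R]_d) :=
  [/\ measurable_fun setT tau,
      forall i j, (fun w => tau (X w) i j) \in Lfun P 1 &
      forall g : 'cV[R]_d -> R, (forall x, differentiable g x) ->
        Lvector 1 (fun w => g (X w) *: X w) ->
        Lvector 1 (fun w => tau (X w) *m gradient g (X w)) ->
        forall i, 'E_P[fun w => (g (X w) *: X w) i ord0] =
                  'E_P[fun w => (tau (X w) *m gradient g (X w)) i ord0]]%E.

End random_vectors.

(* Main.v *)
Require Import Defs.
From HB Require Import structures.
From mathcomp Require Import all_boot all_order all_algebra.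
From mathcomp Require Import all_classical all_reals all_analysis.
From mathcomp Require Import measurable_realfun ring lra.

Set Implicit Arguments.
Unset Strict Implicit.
Unset Printing Implicit Defensive.

Import Order.TTheory GRing.Theory Num.Theory.
Import numFieldNormedType.Exports.

Local Open Scope classical_set_scope.
Local Open Scope ring_scope.

(** Write a = sqrt t, s = sqrt (1 - t) and Q = C^-1. Given F = y, the vector F_t
    has the Gaussian density k(x, y) = s^-d gamma(z), z = (x - a y) / s, so that
    f_t(x) = E[k(x, F)], a conditional expectation of r(F_t, F) given F_t = x is
    E[r(x, F) k(x, F)] / f_t(x), and differentiating under the expectation,
    grad f_t(x) = - s^-1 E[Q z k(x, F)]. For fixed x, k(x, .) is an admissible
    test function in Stein's identity, because z gamma(z) is bounded; as
    grad_y k = (a / s) Q z k, this gives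
    E[F k(x, F)] = (a / s) E[tau(F) Q z k(x, F)]. The relation s z = x - a F then
    expresses E[tau(F) Q z k] through E[z k] and f_t(x), and the formula for the
    score is linear algebra. *)

(** The theorem concerns every smooth positive density [ft] of F_t, whereas the computation controls
    the explicit mixture x |-> E[k(x, F)]. A law determines its density only almost everywhere and
    the score involves derivatives, so the two are identified pointwise: both are continuous, and
    Lebesgue measure charges every ball. The Gaussian enters through the form q(x, y) = x^T Q y: the
    exponent is differentiated along lines, and Cauchy-Schwarz for q bounds x_i^2 by C_ii q(x, x),
    which yields every bound on z gamma(z). Since tau(F) is merely integrable, the bounds on k and
    on Q z k have to be uniform in y. Conditional expectations are handled as unnormalised moments
    E[r(x, F) k(x, F)], finite at every x, and the division by f_t comes last. A constant left
    factor A in A (I - Q tau(F)) Q Z covers both assertions, with A = I and A = Gamma_t. *)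

(** * Change of variables towards a measure with a density *)

Section transfer_density.
Local Open Scope ereal_scope.
Context d1 d2 (X : measurableType d1) (Y : measurableType d2) (R : realType).
Variables (mu : {measure set X -> \bar R}) (nu : {measure set Y -> \bar R}).
Variables (phi : X -> Y) (k : Y -> R).
Hypotheses (mphi : measurable_fun setT phi) (mk : measurable_fun setT k).
Hypothesis k0 : forall y, (0 <= k y)%R.
Hypothesis law : forall A, measurable A ->
  mu (phi @^-1` A) = \int[nu]_(y in A) (k y)%:E.

Import HBNNSimple.

Let mpre A : measurable A -> measurable (phi @^-1` A).
Proof. by move=> mA; rewrite -[X in measurable X]setTI; exact: mphi. Qed.

(** Hypothesis [law] is the case of indicators; linearity extends it to simple functions, and
    monotone convergence to nonnegative measurable functions. *)
Let integral_indic_transfer A : measurable A ->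
  \int[mu]_x (\1_A (phi x))%:E = \int[nu]_y ((\1_A y)%:E * (k y)%:E).
Proof.
move=> mA.
rewrite (_ : (fun x => _) = (fun x => (\1_(phi @^-1` A) x)%:E)); last first.
  by apply/funext => x; rewrite !indicE.
rewrite integral_indic//; last exact: mpre.
rewrite setIT law// [LHS]integral_mkcond; apply: eq_integral => y _.
by rewrite patchE indicE; case: ifPn => _; rewrite ?mul1e ?mul0e.
Qed.

Let integral_nnsfun_transfer (f : {nnsfun Y >-> R}) :
  \int[mu]_x (f (phi x))%:E = \int[nu]_y ((f y)%:E * (k y)%:E).
Proof.
under [LHS]eq_integral do rewrite fimfunE -fsumEFin//.
rewrite [LHS]ge0_integral_fsum//; last 2 first.
  - move=> r; apply/measurable_EFinP; apply: measurable_funM => //.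
    exact: (measurableT_comp _ mphi).
  - by move=> n x _; rewrite EFinM nnfun_muleindic_ge0.
under [RHS]eq_integral.
  move=> x xD; rewrite fimfunE -fsumEFin// muleC ge0_mule_fsumr; last first.
    by move=> r; rewrite EFinM nnfun_muleindic_ge0.
  over.
rewrite [RHS]ge0_integral_fsum//; last 2 first.
  - move=> r; apply: emeasurable_funM; first exact/measurable_EFinP.
    by apply/measurable_EFinP/measurable_funM.
  - move=> n x _; rewrite mule_ge0//; first by rewrite lee_fin.
    by rewrite EFinM nnfun_muleindic_ge0.
apply: eq_fsbigr => r _.
(* Membership of r in the range of f has been dropped, so negative values are treated apart: their
   preimage under a nonnegative function is empty. *)
have [r0|r0] := ltP r 0%R.
  rewrite !integral0_eq// => x _; rewrite preimage_nnfun0// indic0 mulr0//.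
  by rewrite mule0.
under eq_integral do rewrite EFinM.
rewrite ge0_integralZl//; last first.
  by apply/measurable_EFinP; exact: (measurableT_comp _ mphi).
rewrite integral_indic_transfer//.
rewrite -ge0_integralZl//.
- by apply: eq_integral => y _; rewrite EFinM muleA muleC.
- by apply: emeasurable_funM; apply/measurable_EFinP.
- by move=> y _; rewrite mule_ge0 ?lee_fin.
Qed.

Lemma ge0_integral_transfer (f : Y -> \bar R) :
  measurable_fun setT f -> (forall y, 0 <= f y) ->
  \int[mu]_x f (phi x) = \int[nu]_y (f y * (k y)%:E).
Proof.
move=> mf f0; pose f_ := nnsfun_approx measurableT mf.
transitivity (limn (fun n => \int[mu]_x (f_ n (phi x))%:E)).
  rewrite -monotone_convergence//.
  - apply: eq_integral => x _; apply/esym/cvg_lim => //=.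
    by apply: cvg_nnsfun_approx => // y _; exact: f0.
  - by move=> n; apply/measurable_EFinP; exact: (measurableT_comp _ mphi).
  - by move=> n x _; rewrite lee_fin.
  - by move=> x _ a b ab; rewrite lee_fin//; exact/lefP/nd_nnsfun_approx.
transitivity (limn (fun n => \int[nu]_y ((f_ n y)%:E * (k y)%:E))).
  by congr (limn _); apply/funext => n; rewrite integral_nnsfun_transfer.
rewrite -monotone_convergence//.
- apply: eq_integral => y _; apply/cvg_lim => //=.
  by apply: cvgeZr => //; exact: cvg_nnsfun_approx.
- by move=> n; apply: emeasurable_funM; apply/measurable_EFinP.
- by move=> n y _; rewrite mule_ge0 ?lee_fin.
- move=> y _ a b ab; rewrite lee_wpmul2r ?lee_fin//.
  exact/lefP/nd_nnsfun_approx.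
Qed.

(* Both sides are split into positive and negative parts, so that no
   integrability is needed. *)
Lemma integral_transfer (f : Y -> \bar R) : measurable_fun setT f ->
  \int[mu]_x f (phi x) = \int[nu]_y (f y * (k y)%:E).
Proof.
move=> mf; rewrite [LHS]integralE [RHS]integralE.
have kE y : 0 <= (k y)%:E by rewrite lee_fin.
congr (_ - _).
- transitivity (\int[nu]_y (f^\+ y * (k y)%:E)).
    have := ge0_integral_transfer (measurable_funepos mf).
    move=> <-; last exact: funepos_ge0.
    by apply: eq_integral => x _; rewrite !funeposE.
  by apply: eq_integral => y _; rewrite !funeposE maxe_pMl// mul0e.
- transitivity (\int[nu]_y (f^\- y * (k y)%:E)).
    have := ge0_integral_transfer (measurable_funeneg mf).
    move=> <-; last exact: funeneg_ge0.
    by apply: eq_integral => x _; rewrite !funenegE.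
  by apply: eq_integral => y _; rewrite !funenegE maxe_pMl// mul0e mulNe.
Qed.

End transfer_density.

(** * Measurability of matrix operations *)

Section measurable_matrix_operations.
Context d (T : measurableType d) (R : realType).

Lemma measurable_fun_addmx m n (f g : T -> 'M[R]_(m, n)) :
  measurable_fun setT f -> measurable_fun setT g ->
  measurable_fun setT (fun x => f x + g x).
Proof.
move=> /measurable_fun_matrixP mf /measurable_fun_matrixP mg.
apply/measurable_fun_matrixP => i j.
by under eq_fun do rewrite mxE; exact: measurable_funD.
Qed.

Lemma measurable_fun_scalemx m n (a : T -> R) (f : T -> 'M[R]_(m, n)) :
  measurable_fun setT a -> measurable_fun setT f ->
  measurable_fun setT (fun x => a x *: f x).
Proof.
move=> ma /measurable_fun_matrixP mf; apply/measurable_fun_matrixP => i j.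
by under eq_fun do rewrite mxE; exact: measurable_funM.
Qed.

Lemma measurable_fun_oppmx m n (f : T -> 'M[R]_(m, n)) :
  measurable_fun setT f -> measurable_fun setT (fun x => - f x).
Proof.
move=> mf; under eq_fun do rewrite -scaleN1r.
by apply: measurable_fun_scalemx => //; exact: measurable_cst.
Qed.

Lemma measurable_fun_mulmx m n p (f : T -> 'M[R]_(m, n)) (g : T -> 'M[R]_(n, p)) :
  measurable_fun setT f -> measurable_fun setT g ->
  measurable_fun setT (fun x => f x *m g x).
Proof.
move=> /measurable_fun_matrixP mf /measurable_fun_matrixP mg.
apply/measurable_fun_matrixP => i j.
under eq_fun do rewrite mxE.
by apply: measurable_sum => k; exact: measurable_funM.
Qed.

Lemma measurable_fun_coord m n (f : T -> 'M[R]_(m, n)) i j :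
  measurable_fun setT f -> measurable_fun setT (fun x => f x i j).
Proof. by move=> /measurable_fun_matrixP. Qed.

End measurable_matrix_operations.

(** * Lebesgue measure on column vectors: slicing and affine substitution *)

Section lebesgue_measure_cV_theory.
Context {R : realType}.

(** Uniqueness of Lebesgue measure: s times the image measure gives each interval ]u, v] its length.
    The right-hand side is kept as the integral of a constant density so as to match the hypothesis
    of the transfer lemmas. *)
Lemma lebesgue_measure_affine (b s : R) (A : set (measurableTypeR R)) :
    0 < s -> measurable A ->
  (lebesgue_measure ((fun x : measurableTypeR R => (b + s * x)%R) @^-1` A) =
   \int[lebesgue_measure]_(x in A) (s^-1)%:E)%E.
Proof.
move=> s0 mA; rewrite integral_cst//.
have mphi : measurable_fun [set: measurableTypeR R]
    ((fun x => b + s * x) : _ -> measurableTypeR R).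
  by apply: measurable_funD => //; exact: measurable_funM.
pose phi : {mfun measurableTypeR R >-> measurableTypeR R} :=
  HB.pack (fun x : measurableTypeR R => b + s * x : measurableTypeR R)
    (isMeasurableFun.Build _ _ _ _ _ mphi).
rewrite [X in _ = (_ * X)%E](@lebesgue_measure_unique R
  (mscale (NngNum (ltW s0)) (pushforward lebesgue_measure phi)))//.
  by rewrite /mscale/= muleA -EFinM mulVf ?gt_eqF// mul1e.
move=> _ [[u v] _ <-].
change (lebesgue_measure `]u, v]%classic = s%:E *
  lebesgue_measure ((fun x : measurableTypeR R => (b + s * x)%R) @^-1`
    `]u, v]%classic))%E.
rewrite (_ : (fun x : measurableTypeR R => b + s * x) @^-1` _ =
    `](u - b) / s, (v - b) / s]%classic); last first.
  apply/seteqP; split => x /=; rewrite !in_itv/= ltr_pdivrMr// ler_pdivlMr//;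
  by rewrite ltrBlDl lerBrDl mulrC.
rewrite !lebesgue_measure_itv/= !lte_fin ltr_pM2r ?invr_gt0// ltrD2r.
case: ifPn => _; last by rewrite mule0.
by rewrite -!EFinD -EFinM; congr EFin; field; rewrite gt_eqF.
Qed.

(** The measure in dimension n + 1 is by construction the image of a product under [cons_cV], so a
    transfer with density 1 followed by Tonelli suffices. *)
Lemma ge0_integral_lebesgue_cVS n (f : 'cV[R]_n.+1 -> \bar R) :
    measurable_fun setT f -> (forall x, 0 <= f x)%E ->
  (\int[lebesgue_measure_cV n.+1]_x f x =
   \int[lebesgue_measure]_x \int[lebesgue_measure_cV n]_v f (cons_cV (x, v)))%E.
Proof.
move=> mf f0.
have mc := @measurable_cons_cV R n.
transitivity (\int[lebesgue_measure \x lebesgue_measure_cV n]_p f (cons_cV p))%E.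
  have := @ge0_integral_transfer _ _ _ _ _
    (lebesgue_measure \x lebesgue_measure_cV n)%E
    (lebesgue_measure_cV n.+1) cons_cV (cst 1) mc.
  move=> -> //.
  - by apply: eq_integral => x _; rewrite mule1.
  - by move=> A mA; rewrite [RHS](@integral_cst _ _ _ _ _ mA 1) mul1e.
rewrite fubini_tonelli1//.
exact: (measurableT_comp mf mc).
Qed.

(** Induction on the dimension: with the first coordinate fixed, the other n contribute s^-n, and
    the substitution on the line contributes the last factor. In dimension 0 there is a single
    point. *)
Lemma ge0_integral_lebesgue_cV_affine n (b : 'cV[R]_n) (s : R)
    (f : 'cV[R]_n -> \bar R) :
    0 < s -> measurable_fun setT f -> (forall x, 0 <= f x)%E ->
  (\int[lebesgue_measure_cV n]_x f (b + s *: x)%R =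
   (s^-1 ^+ n)%:E * \int[lebesgue_measure_cV n]_x f x)%E.
Proof.
move=> s0; elim: n b f => [|n IH] b f mf f0.
  rewrite expr0 mul1e; apply: eq_integral => x _; congr f.
  by apply/matrixP => -[].
have maff : measurable_fun setT (fun x : 'cV[R]_n.+1 => b + s *: x).
  by apply: measurable_fun_addmx => //; apply: measurable_fun_scalemx.
have mfc : measurable_fun setT
    (fun p : measurableTypeR R * 'cV[R]_n => f (cons_cV p)).
  by apply: (measurableT_comp mf); exact: measurable_cons_cV.
pose b1 := b ord0 ord0; pose b2 : 'cV_n := dsubmx (b : 'cV_(1 + n)).
pose g (x : measurableTypeR R) :=
  (\int[lebesgue_measure_cV n]_v f (cons_cV (x, v)))%E.
have mg : measurable_fun setT g.
  exact: (measurable_fun_fubini_tonelli_F _ mfc).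
have g0 x : (0 <= g x)%E by exact: integral_ge0.
rewrite ge0_integral_lebesgue_cVS//; last exact: (measurableT_comp mf maff).
rewrite [in RHS]ge0_integral_lebesgue_cVS//.
have affE (x : measurableTypeR R) v :
    b + s *: cons_cV (x, v) = cons_cV (b1 + s * x : measurableTypeR R, b2 + s *: v).
  rewrite /cons_cV/=; apply/matrixP => i j; rewrite !mxE (ord1 j).
  case: splitP => k ik; rewrite !mxE; last first.
    by congr (b _ _ + _); exact/val_inj.
  by rewrite /b1; congr (b _ _ + _); apply/val_inj; rewrite /= ?ik ?(ord1 k).
under eq_integral => x _.
  under eq_integral => v _ do rewrite affE.
  rewrite (IH b2 (fun v => f (cons_cV (b1 + s * x : measurableTypeR R, v))))//.
    over.
  exact: (measurableT_comp mfc).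
have mphi : measurable_fun [set: measurableTypeR R]
    ((fun x => b1 + s * x) : _ -> measurableTypeR R).
  by apply: measurable_funD => //; exact: measurable_funM.
transitivity (\int[lebesgue_measure]_x
    ((s^-1 ^+ n)%:E * g (b1 + s * x : measurableTypeR R)%R))%E => //.
have s1 : 0 <= s^-1 by rewrite invr_ge0 ltW.
rewrite ge0_integralZl//; last 2 first.
- exact: (measurableT_comp mg mphi).
- by rewrite lee_fin exprn_ge0.
have := @ge0_integral_transfer _ _ _ _ _ lebesgue_measure lebesgue_measure
  ((fun x => b1 + s * x) : _ -> measurableTypeR R) (cst s^-1) mphi.
move=> -> //; last by move=> A mA; exact: lebesgue_measure_affine.
under eq_integral do rewrite /= muleC.
by rewrite ge0_integralZl//= ?lee_fin// muleA -EFinM exprSr.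
Qed.

End lebesgue_measure_cV_theory.

(** * Independence as a product law *)

Section independence.
Local Open Scope ereal_scope.
Context d (T : measurableType d) (R : realType) (P : probability T R).

(** Independence says that the joint law and the product of the laws agree on rectangles; uniqueness
    of the product measure does the rest. *)
Lemma ge0_integral_independent m n (X : {mfun T >-> 'cV[R]_m})
    (Y : {mfun T >-> 'cV[R]_n}) (f : 'cV[R]_m * 'cV[R]_n -> \bar R) :
    independent_vectors P X Y -> measurable_fun setT f -> (forall p, 0 <= f p) ->
  \int[P]_w f (X w, Y w) =
  \int[distribution P X]_x \int[distribution P Y]_y f (x, y).
Proof.
move=> XY mf f0.
have mXY : measurable_fun setT (fun w => (X w, Y w)).
  by apply/measurable_fun_pair; [exact: measurable_funPT|exact: measurable_funPT].
transitivity (\int[pushforward P (fun w => (X w, Y w))]_p f p).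
  by rewrite ge0_integral_pushforward.
rewrite -fubini_tonelli1//; apply/esym/eq_measure_integral => A mA _.
by apply: product_measure_unique => // B C mB mC; exact: XY.
Qed.

End independence.

(** * Lebesgue measure charges every ball *)

Section lebesgue_measure_cV_support.
Context {R : realType}.

Lemma lebesgue_measure_cV_setT_neq0 n :
  lebesgue_measure_cV n [set: 'cV[R]_n] != 0%E.
Proof.
elim: n => [|n IH]; first by rewrite /= diracT oner_neq0.
change ((lebesgue_measure \x lebesgue_measure_cV n)%E
  (@cons_cV R n @^-1` setT) != 0%E).
rewrite preimage_setT -setXTT product_measure1E//.
rewrite mule_neq0//.
have := @lebesgue_measure_itv R `]-oo, +oo[.
by rewrite set_itvNyy/= => ->.
Qed.

(** Upgrades an identification of densities from almost everywhere to everywhere, so that their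
    gradients may be compared. *)
Lemma ae_eq_continuous n (f g : 'cV[R]_n -> R) :
    continuous f -> continuous g ->
  {ae lebesgue_measure_cV n, forall x, f x = g x} -> forall x, f x = g x.
Proof.
move=> cf cg [N [mN N0 fgN]] x; apply/eqP; apply/negPn/negP => fgx.
have /nbhs_ballP[e /= e0 eN] : \forall y \near x, N y.
  have cfg : {for x, continuous (f \- g)}.
    by apply: continuousB; [exact: cf|exact: cg].
  have nz : nbhs ((f \- g) x) [set z : R | z != 0].
    by apply: open_nbhs_nbhs; split; [exact: open_neq|rewrite /= subr_eq0].
  apply: (@filterS _ (nbhs x) _ _ _ _ (cfg _ nz)) => y /=.
  by rewrite subr_eq0 => /eqP; exact: fgN.
have mphi (k : nat) : measurable_fun setT (fun y : 'cV[R]_n => x + k.+1%:R^-1 *: y).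
  by apply: measurable_fun_addmx => //; apply: measurable_fun_scalemx.
have mNk (k : nat) : measurable ((fun y : 'cV[R]_n => x + k.+1%:R^-1 *: y) @^-1` N).
  by rewrite -[X in measurable X]setTI; exact: mphi.
(* Scaling up a null neighbourhood of [x] makes the whole space null. *)
have N0k (k : nat) :
    lebesgue_measure_cV n ((fun y : 'cV[R]_n => x + k.+1%:R^-1 *: y) @^-1` N) = 0%E.
  have := @ge0_integral_lebesgue_cV_affine R n x k.+1%:R^-1
    (fun y => (\1_N y)%:E).
  have -> : (\int[lebesgue_measure_cV n]_y (\1_N y)%:E = 0)%E.
    by rewrite integral_indic// setIT.
  rewrite mule0 => H.
  transitivity (\int[lebesgue_measure_cV n]_y
    (\1_((fun y : 'cV[R]_n => x + k.+1%:R^-1 *: y) @^-1` N) y)%:E)%E.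
    by rewrite integral_indic// setIT.
  apply: H; rewrite ?invr_gt0//.
  exact/measurable_EFinP/measurable_indic.
have /negP := lebesgue_measure_cV_setT_neq0 n; apply; rewrite -measure_le0.
rewrite -(_ : \bigcup_k ((fun y : 'cV[R]_n => x + k.+1%:R^-1 *: y) @^-1` N) = setT).
  apply: (le_trans (measure_sigma_subadditive _ _ _ _)); last first.
    by rewrite eseries0// => i _ _; exact: N0k.
  - by [].
  - exact: bigcup_measurable.
  - by [].
(* With k the integer part of |y| / e, one has |y| / (k + 1) < e, so the contracted point lies in
   the ball of radius e around x. *)
apply/seteqP; split => // y _; exists (Num.truncn (`|y| / e)) => //=.
apply: eN; rewrite -ball_normE/= opprD addrA subrr add0r normrN normrZ.
rewrite ger0_norm ?invr_ge0// mulrC ltr_pdivrMr// -ltr_pdivrMl// mulrC.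
exact: truncnS_gt.
Qed.

End lebesgue_measure_cV_support.

(** * The joint law of the noisy vector and the signal *)

Section noisy_law.
Context d (T : measurableType d) (R : realType) (P : probability T R) (n : nat).
Variables (X Z : {mfun T >-> 'cV[R]_n}) (gam : 'cV[R]_n -> R) (a s : R).
Hypotheses (XZ : independent_vectors P X Z) (Zgam : has_density P Z gam).
Hypothesis s0 : 0 < s.

(* The density at x of a y + s Z. *)
Definition noise_kernel (x y : 'cV[R]_n) : R :=
  s^-1 ^+ n * gam (s^-1 *: (x - a *: y)).

Lemma noise_kernel_ge0 x y : 0 <= noise_kernel x y.
Proof.
by case: Zgam => _ gam0 _; rewrite mulr_ge0// exprn_ge0// invr_ge0 ltW.
Qed.

Lemma measurable_noise_kernel :
  measurable_fun setT (fun p : 'cV[R]_n * 'cV[R]_n => noise_kernel p.1 p.2).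
Proof.
case: Zgam => mgam _ _; apply: measurable_funM => //.
apply: (measurableT_comp mgam); apply: measurable_fun_scalemx => //.
apply: measurable_fun_addmx; first exact: measurable_fst.
apply: measurable_fun_oppmx; apply: measurable_fun_scalemx => //.
Qed.

Let phi w := (a *: X w + s *: Z w, X w).

Let mphi : measurable_fun setT phi.
Proof.
apply/measurable_fun_pair; last exact: measurable_funPT.
by apply: measurable_fun_addmx; apply: measurable_fun_scalemx => //;
  exact: measurable_funPT.
Qed.

Local Notation PX := (distribution P X).
Local Notation PZ := (distribution P Z).

(** For X = y fixed, the substitution x = a y + s z in the integral over the noise produces the
    Jacobian factor s^-n of the kernel. The reference measure in the second variable is the law of X
    itself. *)
Lemma noisy_law (A : set ('cV[R]_n * 'cV[R]_n)) : measurable A ->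
  (P ((fun w => ((a *: X w + s *: Z w)%R, X w)) @^-1` A) =
   \int[lebesgue_measure_cV n \x PX]_(p in A) (noise_kernel p.1 p.2)%:E)%E.
Proof.
move=> mA; case: (Zgam) => mgam gam0 lawZ.
pose f (p : 'cV[R]_n * 'cV[R]_n) : \bar R :=
  (\1_A (a *: p.1 + s *: p.2, p.1))%:E.
have mpair : measurable_fun setT (fun p : 'cV[R]_n * 'cV[R]_n =>
    (a *: p.1 + s *: p.2, p.1)).
  apply/measurable_fun_pair; last exact: measurable_fst.
  by apply: measurable_fun_addmx; apply: measurable_fun_scalemx.
have mf : measurable_fun setT f.
  by apply/measurable_EFinP; exact: (measurableT_comp (measurable_indic _) mpair).
transitivity (\int[P]_w f (X w, Z w))%E.
  transitivity (\int[P]_w (\1_(phi @^-1` A) w)%:E)%E => //.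
  rewrite integral_indic ?setIT// -[X in measurable X]setTI; exact: mphi.
rewrite (ge0_integral_independent XZ)//; last by move=> p; rewrite lee_fin.
rewrite [RHS]integral_mkcond fubini_tonelli2; first last.
- move=> p; rewrite erestrict_ge0// => q _; rewrite lee_fin.
  exact: noise_kernel_ge0.
- apply/(measurable_restrictT _ mA)/measurable_funTS/measurable_EFinP.
  exact: measurable_noise_kernel.
apply: eq_integral => y _; rewrite /fubini_G.
pose g (x : 'cV[R]_n) : \bar R :=
  ((\1_A (x, y))%:E * (gam (s^-1 *: (x - a *: y)))%:E)%E.
have mg : measurable_fun setT g.
  apply/emeasurable_funM; apply/measurable_EFinP.
    exact: (measurableT_comp (measurable_indic _) (measurable_pair2 y)).
  apply: (measurableT_comp mgam); apply: measurable_fun_scalemx => //.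
  by apply: measurable_fun_addmx.
transitivity (\int[lebesgue_measure_cV n]_z g (a *: y + s *: z)%R)%E.
  have := @ge0_integral_transfer _ _ _ _ _ PZ (lebesgue_measure_cV n) id gam
    (@measurable_id _ _ _) mgam gam0 lawZ (fun z => f (y, z)).
  move=> -> //; last 2 first.
  - exact: (measurableT_comp mf (measurable_pair1 y)).
  - by move=> z; rewrite lee_fin.
  apply: eq_integral => z _; rewrite /g/= [_ + _ - _]addrC addKr.
  by rewrite scalerA mulVf ?gt_eqF// scale1r.
rewrite ge0_integral_lebesgue_cV_affine//; last first.
  by move=> x; rewrite mule_ge0 ?lee_fin.
rewrite -ge0_integralZl//; last 2 first.
- by move=> x _; rewrite mule_ge0 ?lee_fin.
- by rewrite lee_fin exprn_ge0// invr_ge0 ltW.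
apply: eq_integral => x _; rewrite patchE /g indicE/= /noise_kernel.
by case: ifPn => _; rewrite ?mul1e ?mul0e ?mule0.
Qed.

End noisy_law.

(** * Joint densities and unnormalised conditional moments *)

Section set_integral_transfer.
Local Open Scope ereal_scope.
Context d1 d2 (X : measurableType d1) (Y : measurableType d2) (R : realType).
Variables (mu : {measure set X -> \bar R}) (nu : {measure set Y -> \bar R}).
Variables (phi : X -> Y) (k : Y -> R).
Hypotheses (mphi : measurable_fun setT phi) (mk : measurable_fun setT k).
Hypothesis k0 : forall y, (0 <= k y)%R.
Hypothesis law : forall A, measurable A ->
  mu (phi @^-1` A) = \int[nu]_(y in A) (k y)%:E.

Lemma set_integral_transfer A (f : Y -> \bar R) : measurable A ->
  measurable_fun setT f ->
  \int[mu]_(x in phi @^-1` A) f (phi x) = \int[nu]_(y in A) (f y * (k y)%:E).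
Proof.
move=> mA mf.
rewrite [RHS]integral_mkcond.
transitivity (\int[nu]_y ((f \_ A) y * (k y)%:E)); last first.
  by apply: eq_integral => y _; rewrite !patchE; case: ifPn; rewrite ?mul0e.
rewrite -(integral_transfer mphi mk k0 law); last first.
  by apply/(measurable_restrictT _ mA)/measurable_funTS.
by rewrite integral_mkcond; apply: eq_integral.
Qed.

Lemma integrable_transfer (f : Y -> R) : measurable_fun setT f ->
  mu.-integrable setT (fun x => (f (phi x))%:E) <->
  nu.-integrable setT (fun y => (f y * k y)%:E).
Proof.
move=> mf.
have E : \int[mu]_x `|(f (phi x))%:E| = \int[nu]_y `|(f y * k y)%:E|.
  under [RHS]eq_integral do rewrite abse_EFin normrM (ger0_norm (k0 _)) EFinM.
  rewrite -(integral_transfer mphi mk k0 law (f := fun y => `|f y|%:E))//.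
  by apply/measurable_EFinP; exact: measurableT_comp.
split=> /integrableP[_ H]; apply/integrableP; split.
- by apply/measurable_EFinP; exact: measurable_funM.
- by rewrite -E.
- by apply/measurable_EFinP; exact: (measurableT_comp mf).
- by rewrite E.
Qed.

End set_integral_transfer.

(* In this section K is the joint density of (Y, X) with respect to mu \x m,
   where Y takes its values in V, X in U. *)
Section disintegration.
Context d (T : measurableType d) (R : realType) (P : probability T R).
Context dU dV (U : measurableType dU) (V : measurableType dV).
Variables (m : {sigma_finite_measure set U -> \bar R}).
Variables (mu : {sigma_finite_measure set V -> \bar R}).
Variables (X : T -> U) (Y : T -> V) (K : V -> U -> R).
Hypotheses (mYX : measurable_fun setT (fun w => (Y w, X w))).
Hypothesis mK : measurable_fun setT (fun p : V * U => K p.1 p.2).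
Hypothesis K0 : forall x y, 0 <= K x y.
Hypothesis law : forall A, measurable A ->
  (P ((fun w => (Y w, X w)) @^-1` A) = \int[mu \x m]_(p in A) (K p.1 p.2)%:E)%E.

Variable r : V * U -> R.
Hypothesis mr : measurable_fun setT r.
Hypothesis ir : P.-integrable setT (fun w => (r (Y w, X w))%:E).
Hypothesis irK : forall x, m.-integrable setT (fun y => (r (x, y) * K x y)%:E).

(** The numerator of Bayes' formula: E[r(Y, X) | Y = x] multiplied by the density of Y at x. *)
Definition conditional_moment x := \int[m]_y (r (x, y) * K x y).

Let irKp : (mu \x m)%E.-integrable setT (fun p => (r p * K p.1 p.2)%:E).
Proof.
exact/(integrable_transfer mYX mK (fun p => K0 p.1 p.2) law).
Qed.

(** Fubini would make slices integrable only for almost every x; [irK] asks for it at every x, so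
    the passage to real values loses nothing anywhere. *)
Let conditional_momentE x :
  (conditional_moment x)%:E = fubini_F m (fun p => (r p * K p.1 p.2)%:E) x.
Proof. by rewrite /conditional_moment fineK// integrable_fin_num. Qed.

Lemma integrable_conditional_moment :
  mu.-integrable setT (EFin \o conditional_moment).
Proof.
apply: eq_integrable (integrable_fubini_F irKp) => // x _.
by rewrite /= conditional_momentE.
Qed.

Lemma set_integral_conditional_moment A : measurable A ->
  (\int[P]_(w in Y @^-1` A) (r (Y w, X w))%:E =
   \int[mu]_(x in A) (conditional_moment x)%:E)%E.
Proof.
move=> mA.
have mAU : measurable (A `*` [set: U]) by exact: measurableX.
transitivity (\int[P]_(w in (fun w => (Y w, X w)) @^-1` (A `*` setT))
    (r (Y w, X w))%:E)%E.
  by congr (integral _ _ _); apply/seteqP; split => w //= [].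
rewrite (set_integral_transfer mYX mK (fun p => K0 p.1 p.2) law mAU
  (f := fun p => (r p)%:E)); last exact/measurable_EFinP.
rewrite integral_mkcond -integral12_prod_meas1; last first.
  apply/(integrable_mkcond _ mAU)/(@integrableS _ _ _ _ setT) => //.
rewrite [RHS]integral_mkcond; apply: eq_integral => x _.
rewrite patchE /fubini_F; case: ifPn => xA.
  rewrite conditional_momentE; apply: eq_integral => y _.
  by rewrite patchE in_setX xA in_setT.
by apply: integral0_eq => y _; rewrite patchE in_setX (negbTE xA).
Qed.

End disintegration.

(** * The form of the inverse covariance matrix *)

Section positive_definite.
Context {R : realType} {n : nat}.
Variable C : 'M[R]_n.
Hypothesis Cpos : posdefmx C.

Local Notation Q := (invmx C).

(** Bilinear rather than quadratic: the diagonal gives the Gaussian exponent, and the value at (v,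
    x) gives its derivative at x in the direction v. *)
Definition precision_form (x y : 'cV[R]_n) : R := (x^T *m Q *m y) ord0 ord0.

Lemma posdefmx_unit : C \in unitmx.
Proof.
case: Cpos => _ C0; rewrite unitmxE unitfE; apply/negP => /det0P[v v0 vC].
have := C0 v^T; rewrite trmxK vC mul0mx mxE ltxx.
by rewrite -[0]trmx0 (can_eq (@trmxK _ _ _)) => /(_ v0).
Qed.

Lemma precision_formC x y : precision_form x y = precision_form y x.
Proof.
rewrite /precision_form -[LHS](mxE trmx_key (fun i j => (x^T *m Q *m y) j i)).
rewrite -/(trmx _) !trmx_mul trmxK trmx_inv (proj1 Cpos).
by rewrite mulmxA.
Qed.

Lemma precision_formDl x y z :
  precision_form (x + y) z = precision_form x z + precision_form y z.
Proof. by rewrite /precision_form linearD /= !mulmxDl mxE. Qed.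

Lemma precision_formZl a x y :
  precision_form (a *: x) y = a * precision_form x y.
Proof. by rewrite /precision_form linearZ /= -!scalemxAl mxE. Qed.

Lemma precision_formDr x y z :
  precision_form x (y + z) = precision_form x y + precision_form x z.
Proof. by rewrite !(precision_formC x) precision_formDl. Qed.

Lemma precision_formZr a x y :
  precision_form x (a *: y) = a * precision_form x y.
Proof. by rewrite !(precision_formC x) precision_formZl. Qed.

(** Since Q = Q C Q with Q symmetric, this is the form of C at Q x. *)
Lemma precision_form_ge0 x : 0 <= precision_form x x.
Proof.
have -> : precision_form x x = ((Q *m x)^T *m C *m (Q *m x)) ord0 ord0.
  rewrite /precision_form trmx_mul trmx_inv (proj1 Cpos) !mulmxA.
  by rewrite mulmxKV ?posdefmx_unit.
have [->|Qx0] := eqVneq (Q *m x) 0; first by rewrite mulmx0 mxE.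
by apply/ltW; case: Cpos => _; exact.
Qed.

Lemma precision_form_delta i x :
  precision_form (delta_mx i ord0) x = (Q *m x) i ord0.
Proof.
by rewrite /precision_form trmx_delta -mulmxA -rowE mxE.
Qed.

Lemma posdefmx_diag_gt0 i : 0 < C i i.
Proof.
have : (delta_mx i ord0 : 'cV[R]_n) != 0.
  apply/eqP => /matrixP/(_ i ord0); rewrite !mxE !eqxx => /eqP.
  by rewrite oner_eq0.
move=> /(proj2 Cpos); rewrite trmx_delta -mulmxA -rowE mxE -colE.
by rewrite mxE.
Qed.

(* The Cauchy-Schwarz inequality for the precision form and the vector C e_i. *)
Lemma sqr_coord_le i (x : 'cV[R]_n) : x i ord0 ^+ 2 <= C i i * precision_form x x.
Proof.
pose v : 'cV[R]_n := C *m delta_mx i ord0.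
have vE y : precision_form v y = y i ord0.
  rewrite /precision_form trmx_mul (proj1 Cpos) -!mulmxA mulKVmx ?posdefmx_unit//.
  by rewrite trmx_delta -rowE mxE.
have Cii := posdefmx_diag_gt0 i.
(* As q(x, v) = x_i and q(v, v) = C_ii, this coefficient minimises the form on the line x + R v. *)
have := precision_form_ge0 (x + (- (x i ord0 / C i i)) *: v).
rewrite !precision_formDl !precision_formDr !precision_formZl !precision_formZr.
rewrite (precision_formC x v) !vE (_ : v i ord0 = C i i); last first.
  by rewrite /v -colE mxE.
move=> H.
rewrite -subr_ge0.
have : 0 <= C i i * (precision_form x x + - (x i ord0 / C i i) * x i ord0 +
  (- (x i ord0 / C i i) * x i ord0 +
   - (x i ord0 / C i i) * (- (x i ord0 / C i i) * C i i))).
  by rewrite mulr_ge0// ltW.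
by congr (0 <= _); field; rewrite gt_eqF.
Qed.

End positive_definite.

(** * Bounds and derivatives of the Gaussian density *)

Section normal_pdf_theory.
Context {R : realType} {n : nat}.
Variable C : 'M[R]_n.
Hypothesis Cpos : posdefmx C.

Local Notation Q := (invmx C).
Local Notation gam := (normal_pdf_cV C).
Local Notation q := (precision_form C).
Local Notation peak := ((Num.sqrt ((2 * pi) ^+ n * \det C))^-1).

Lemma normal_pdf_cVE x : gam x = peak * expR (- q x x / 2).
Proof. by rewrite /normal_pdf_cV. Qed.

Lemma normal_pdf_cV_ge0 x : 0 <= gam x.
Proof. by rewrite mulr_ge0 ?expR_ge0// invr_ge0 sqrtr_ge0. Qed.

Lemma normal_pdf_cV_le_peak x : gam x <= peak.
Proof.
rewrite normal_pdf_cVE ler_piMr ?invr_ge0 ?sqrtr_ge0//.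
by rewrite -expR0 ler_expR mulNr oppr_le0 divr_ge0// precision_form_ge0.
Qed.

(** Half of the exponent absorbs the coordinate: |x_i| <= 1 + x_i^2 <= 1 + C_ii q, and 1 + q/4 <=
    exp(q/4) turns this into (1 + 4 C_ii) exp(q/4). The half that remains keeps the bound
    integrable. *)
Lemma norm_coord_expR_le i (x : 'cV[R]_n) :
  `|x i ord0| * expR (- q x x / 2) <= (1 + 4 * C i i) * expR (- q x x / 4).
Proof.
have Cii := posdefmx_diag_gt0 Cpos i.
have q0 := precision_form_ge0 Cpos x.
have xi := sqr_coord_le Cpos i x.
rewrite (_ : - q x x / 2 = - q x x / 4 + - q x x / 4); last by field.
rewrite expRD mulrA ler_wpM2r ?expR_ge0//.
have xi1 : `|x i ord0| <= 1 + C i i * q x x.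
  rewrite -(real_normK (num_real _)) in xi.
  have := normr_ge0 (x i ord0); nra.
apply: (le_trans (ler_wpM2r (expR_ge0 _) xi1)).
rewrite mulNr expRN ler_pdivrMr ?expR_gt0//.
have := expR_ge1Dx (q x x / 4); nra.
Qed.

Lemma norm_coord_normal_pdf_le i (x : 'cV[R]_n) :
  `|x i ord0| * gam x <= peak * (1 + 4 * C i i).
Proof.
have p0 : 0 <= peak by rewrite invr_ge0 sqrtr_ge0.
rewrite normal_pdf_cVE mulrCA ler_wpM2l//.
apply: (le_trans (norm_coord_expR_le i x)); rewrite ler_piMr//.
  by rewrite addr_ge0// mulr_ge0// ltW// posdefmx_diag_gt0.
by rewrite -expR0 ler_expR mulNr oppr_le0 divr_ge0// precision_form_ge0.
Qed.

Lemma normal_pdf_cV_mulmx_bounded m (A : 'M[R]_(m, n)) :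
  exists2 M, 0 <= M & forall x i, `|(A *m x) i ord0| * gam x <= M.
Proof.
have p0 : 0 <= peak by rewrite invr_ge0 sqrtr_ge0.
have Cii i : 0 <= C i i by rewrite ltW// posdefmx_diag_gt0.
(* Summing over all rows makes a single bound serve every i. *)
exists (\sum_i \sum_j `|A i j| * (peak * (1 + 4 * C j j))).
  apply: sumr_ge0 => i _; apply: sumr_ge0 => j _.
  by rewrite !mulr_ge0// addr_ge0// mulr_ge0.
move=> x i; rewrite (bigD1 i)//= ler_wpDr//.
  apply: sumr_ge0 => k _; apply: sumr_ge0 => j _.
  by rewrite !mulr_ge0// addr_ge0// mulr_ge0.
rewrite mxE; apply: (@le_trans _ _ (\sum_j `|A i j| * (`|x j ord0| * gam x))).
  rewrite [leRHS](eq_bigr (fun j => `|A i j| * `|x j ord0| * gam x)); last first.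
    by move=> j _; rewrite mulrA.
  rewrite -mulr_suml ler_wpM2r ?normal_pdf_cV_ge0//.
  apply: (le_trans (ler_norm_sum _ _ _)).
  by apply: ler_sum => j _; rewrite normrM.
by apply: ler_sum => j _; rewrite ler_wpM2l// norm_coord_normal_pdf_le.
Qed.

Lemma measurable_normal_pdf_cV : measurable_fun setT gam.
Proof.
apply: measurable_funM => //; apply: measurableT_comp => //.
apply: measurable_funM => //; apply: measurableT_comp => //.
have -> : (fun x : 'cV[R]_n => (x^T *m Q *m x) ord0 ord0) =
    (fun x => \sum_j (\sum_i x i ord0 * Q i j) * x j ord0).
  apply/funext => x; rewrite mxE; apply: eq_bigr => j _; rewrite mxE.
  by congr (_ * _); apply: eq_bigr => i _; rewrite mxE.
apply: measurable_sum => j; apply: measurable_funM; last exact: measurable_entry.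
by apply: measurable_sum => i; apply: measurable_funM => //; exact: measurable_entry.
Qed.

(** On a line the exponent is a quadratic polynomial in u, so calculus in one variable is enough;
    both kernel derivatives come from here. *)
Lemma is_derive_normal_pdf_cV (x v : 'cV[R]_n) (t : R) :
  is_derive t 1 (fun u : R => gam (x + u *: v))
    (- q v (x + t *: v) * gam (x + t *: v)).
Proof.
have E (u : R) : gam (x + u *: v) =
    peak * expR (- (q x x + 2 * u * q v x + u ^+ 2 * q v v) / 2).
  rewrite normal_pdf_cVE !precision_formDl// !precision_formDr//.
  rewrite !precision_formZl// !precision_formZr// (precision_formC Cpos x v).
  by congr (_ * expR _); field.
under eq_fun do rewrite E.
rewrite E precision_formDr// precision_formZr//.
apply: is_derive_eq.
rewrite /GRing.scale/=; set e := expR _; set p := _^-1.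
by clearbody e p; field.
Qed.

(** Stein's identity is available for differentiable test functions, and directional derivatives
    alone do not give differentiability; the exponent is therefore expanded as a polynomial in the
    coordinates. *)
Lemma differentiable_normal_pdf_cV (x : 'cV[R]_n) : differentiable gam x.
Proof.
have qE (y : 'cV[R]_n) :
    q y y = \sum_j (\sum_i y i ord0 * Q i j) * y j ord0.
  rewrite /precision_form mxE; apply: eq_bigr => j _; rewrite mxE.
  by congr (_ * _); apply: eq_bigr => i _; rewrite mxE.
have dcoord i := differentiable_coord x i ord0.
have dq : differentiable (fun y : 'cV[R]_n => q y y) x.
  rewrite (_ : (fun y => _) = \sum_j
      ((\sum_i (fun y : 'cV[R]_n => y i ord0 : R) * cst (Q i j)) *
       (fun y : 'cV[R]_n => y j ord0 : R))); last first.
    apply/funext => y; rewrite qE fct_sumE; apply: eq_bigr => j _.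
    by rewrite !fctE fct_sumE.
  apply: differentiable_sum => j; apply: differentiableM => //.
  by apply: differentiable_sum => i; exact: differentiableM.
rewrite (_ : gam = cst peak * (expR \o (- (fun y : 'cV[R]_n => q y y) * cst 2^-1))).
  apply: differentiableM => //; apply: differentiable_comp.
    by apply: differentiableM => //; exact: differentiableN.
  exact/derivable1_diffP/derivable_expR.
by apply/funext => y; rewrite normal_pdf_cVE.
Qed.

End normal_pdf_theory.

(** * The Gaussian kernel and its mixtures *)

Lemma ler_coord_norm (R : realType) m n (v : 'M[R]_(m, n)) i j : `|v i j| <= `|v|.
Proof.
rewrite [leRHS]/Num.Def.normr/= mx_normrE.
exact: (le_bigmax _ (fun ij => `|v ij.1 ij.2|) (i, j)).
Qed.

(** Reduces a directional derivative to one real parameter, the setting of differentiation under the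
    integral sign. *)
Lemma derive_line (R : realType) (V : normedModType R) (f : V -> R) (x v : V) :
  'D_v f x = 'D_1 (fun u : R => f (x + u *: v)) 0.
Proof.
rewrite /derive (_ : (fun h : R => h^-1 *: ((f \o shift x) (h *: v) - f x)) =
    (fun h => h^-1 *: (((fun u : R => f (x + u *: v)) \o shift 0) (h *: 1) -
      f (x + 0 *: v))))//.
by apply/funext => h /=; rewrite addr0 [h%:A]mulr1 scale0r addr0 [x + _]addrC.
Qed.

Lemma bounded_integrable d (T : measurableType d) (R : realType)
    (m : probability T R) (f : T -> R) (M : R) :
  measurable_fun setT f -> (forall y, `|f y| <= M) ->
  m.-integrable setT (fun y => (f y)%:E).
Proof.
move=> mf fM.
apply: (@le_integrable _ _ _ m setT measurableT _ (EFin \o cst M)); last first.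
- exact: finite_measure_integrable_cst.
- by move=> y _; rewrite /= lee_fin (le_trans (fM y))// ler_norm.
- exact/measurable_EFinP.
Qed.

Section gaussian_kernel.
Context {R : realType} {n : nat}.
Variables (C : 'M[R]_n) (a s : R).
Hypotheses (Cpos : posdefmx C) (s0 : 0 < s).

Local Notation Q := (invmx C).
Local Notation gam := (normal_pdf_cV C).
Local Notation q := (precision_form C).
Local Notation k := (noise_kernel gam a s).
Local Notation peak := ((Num.sqrt ((2 * pi) ^+ n * \det C))^-1).

Definition rescaled_noise (x y : 'cV[R]_n) : 'cV[R]_n := s^-1 *: (x - a *: y).
Local Notation z := rescaled_noise.

Let sn0 : 0 <= s^-1 ^+ n.
Proof. by rewrite exprn_ge0// invr_ge0 ltW. Qed.

Lemma gaussian_kernel_ge0 x y : 0 <= k x y.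
Proof. by rewrite mulr_ge0// normal_pdf_cV_ge0. Qed.

Lemma gaussian_kernel_bounded x y : `|k x y| <= s^-1 ^+ n * peak.
Proof.
rewrite ger0_norm ?gaussian_kernel_ge0//.
by rewrite ler_wpM2l// normal_pdf_cV_le_peak.
Qed.

(** Uniformity in x and y is the point: the same bound dominates the x-derivatives of the kernel and
    makes its product with an integrable tau(F) integrable. *)
Lemma gaussian_kernel_mulmx_bounded m (A : 'M[R]_(m, n)) :
  exists2 M, 0 <= M & forall x y i, `|(A *m z x y) i ord0| * k x y <= M.
Proof.
have [M M0 HM] := normal_pdf_cV_mulmx_bounded Cpos A.
exists (s^-1 ^+ n * M) => [|x y i]; first exact: mulr_ge0.
by rewrite mulrCA ler_wpM2l.
Qed.

Lemma measurable_rescaled_noise :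
  measurable_fun setT (fun p : 'cV[R]_n * 'cV[R]_n => z p.1 p.2).
Proof.
apply: measurable_fun_scalemx => //; apply: measurable_fun_addmx => //.
by apply: measurable_fun_oppmx; apply: measurable_fun_scalemx.
Qed.

Lemma measurable_gaussian_kernel :
  measurable_fun setT (fun p : 'cV[R]_n * 'cV[R]_n => k p.1 p.2).
Proof.
apply: measurable_funM => //.
exact: (measurableT_comp (measurable_normal_pdf_cV C) measurable_rescaled_noise).
Qed.

Lemma is_derive_gaussian_kernel1 (x y v : 'cV[R]_n) (t : R) :
  is_derive t 1 (fun u : R => k (x + u *: v) y)
    (- s^-1 * q v (z (x + t *: v) y) * k (x + t *: v) y).
Proof.
have E u : k (x + u *: v) y = s^-1 ^+ n * gam (z x y + u *: (s^-1 *: v)).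
  by congr (_ * gam _); apply/matrixP => i j; rewrite !mxE; ring.
under eq_fun do rewrite E.
rewrite E.
have D := is_derive_normal_pdf_cV Cpos (z x y) (s^-1 *: v) t.
apply: is_derive_eq; rewrite precision_formZl//.
rewrite (_ : z (x + t *: v) y = z x y + t *: (s^-1 *: v)).
  by move: (q v _) (gam _) => b g; rewrite /GRing.scale/=; ring.
by apply/matrixP => i j; rewrite !mxE; ring.
Qed.

(** Moving y by v moves z by -(a / s) v, while moving x by v moves it by v / s. Hence the gradient
    in y is -a times the gradient in x, which is what links Stein's identity to the score. *)
Lemma is_derive_gaussian_kernel2 (x y v : 'cV[R]_n) (t : R) :
  is_derive t 1 (fun u : R => k x (y + u *: v))
    (a / s * q v (z x (y + t *: v)) * k x (y + t *: v)).
Proof.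
have zE u : z x (y + u *: v) = z x y + u *: (- (a / s) *: v).
  by apply/matrixP => i j; rewrite !mxE; ring.
have E u : k x (y + u *: v) = s^-1 ^+ n * gam (z x y + u *: (- (a / s) *: v)).
  by congr (_ * gam _); exact: zE.
under eq_fun do rewrite E.
rewrite E zE.
have D := is_derive_normal_pdf_cV Cpos (z x y) (- (a / s) *: v) t.
apply: is_derive_eq; rewrite precision_formZl//.
by move: (q v _) (gam _) => b g; rewrite /GRing.scale/=; ring.
Qed.

Lemma differentiable_gaussian_kernel2 x y : differentiable (k x) y.
Proof.
rewrite (_ : k x = cst (s^-1 ^+ n) *
    (gam \o (s^-1 *: (cst x - a *: (id : 'cV[R]_n -> 'cV[R]_n))))).
  apply: differentiableM => //; apply: differentiable_comp.
    by apply: differentiableZ; exact: differentiableB.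
  exact: differentiable_normal_pdf_cV.
by [].
Qed.

Lemma partial_gaussian_kernel2 x y i :
  partial i (k x) y = a / s * (Q *m z x y) i ord0 * k x y.
Proof.
rewrite /partial derive_line.
have := is_derive_gaussian_kernel2 x y (delta_mx i ord0) 0.
by rewrite scale0r addr0 precision_form_delta => D; rewrite derive_val.
Qed.

(** The mean value theorem on the segment from x' to x, with the uniform bound on Q z k. The factor
    n arises because the norm is the largest absolute entry. *)
Lemma gaussian_kernel_lipschitz :
  exists L, forall x x' y, `|k x y - k x' y| <= L * `|x - x'|.
Proof.
have [M M0 HM] := gaussian_kernel_mulmx_bounded Q.
exists (s^-1 * (n%:R * M)) => x x' y.
pose v := x - x'; pose df t := - s^-1 * q v (z (x' + t *: v) y) * k (x' + t *: v) y.
have D (t : R) : is_derive t (1 : R) (fun u : R => k (x' + u *: v) y) (df t).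
  exact: is_derive_gaussian_kernel1.
have cD : {within `[0, 1], continuous (fun u : R => k (x' + u *: v) y)}.
  by apply: derivable_within_continuous => t _; have [] := D t.
have [c _] := MVT ltr01 (fun t _ => D t) cD.
rewrite scale1r scale0r addr0 subr0 mulr1 [x' + v]addrC subrK => ->.
rewrite /df normrM (ger0_norm (gaussian_kernel_ge0 _ _)) normrM normrN.
rewrite (ger0_norm (_ : 0 <= s^-1)) ?invr_ge0 ?(ltW s0)// -!mulrA.
rewrite ler_wpM2l ?invr_ge0 ?(ltW s0)//.
rewrite {1}/precision_form -mulmxA mxE.
apply: (@le_trans _ _ (\sum_(i < n) `|v| * M)); last first.
  by rewrite sumr_const card_ord mulr_natl [M * _]mulrC.
apply: (le_trans (ler_wpM2r (gaussian_kernel_ge0 _ _) (ler_norm_sum _ _ _))).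
rewrite mulr_suml; apply: ler_sum => i _; rewrite normrM mxE -mulrA.
apply: ler_pM => //.
  by rewrite mulr_ge0// gaussian_kernel_ge0.
exact: ler_coord_norm.
Qed.

Variable m : probability 'cV[R]_n R.

Definition gaussian_mixture x := \int[m]_y k x y.
Local Notation G := gaussian_mixture.

Let mk1 x : measurable_fun setT (k x).
Proof. exact: (measurableT_comp measurable_gaussian_kernel (measurable_pair1 x)). Qed.

Lemma integrable_gaussian_kernel x : m.-integrable setT (fun y => (k x y)%:E).
Proof. exact: (bounded_integrable _ (mk1 x) (gaussian_kernel_bounded x)). Qed.

Lemma continuous_gaussian_mixture : continuous G.
Proof.
have [L HL] := gaussian_kernel_lipschitz.
have GL x x' : `|G x - G x'| <= L * `|x - x'|.
  have iB : m.-integrable setT (fun y => (k x y - k x' y)%:E).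
    apply: (bounded_integrable _ _ (HL x x')).
    by apply: measurable_funB; exact: mk1.
  rewrite /G -RintegralB//; try exact: integrable_gaussian_kernel.
  apply: (le_trans (le_normr_Rintegral _ iB)) => //.
  apply: (le_trans (le_Rintegral _ _ _ (fun y _ => HL x x' y))) => //.
  - exact: (integrable_norm iB).
  - exact: finite_measure_integrable_cst.
  - rewrite Rintegral_cst// [X in fine X](_ : _ = 1%E) ?mulr1//.
    exact: probability_setT.
(* The sign of L is unknown; |L| + 1 is a Lipschitz constant by which one may divide. *)
have L0 : 0 < `|L| + 1 by rewrite ltr_wpDl.
move=> x A /nbhs_ballP[e /= e0 eA]; suff : nbhs x (G @^-1` A) by [].
apply/nbhs_ballP; exists (e / (`|L| + 1)) => [|y]; first exact: divr_gt0.
rewrite -ball_normE /= => xy; apply: eA; rewrite -ball_normE /=.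
apply: (le_lt_trans (GL x y)).
apply: (@le_lt_trans _ _ ((`|L| + 1) * `|x - y|)).
  by rewrite ler_wpM2r// (le_trans (ler_norm L))// lerDl.
by rewrite mulrC -ltr_pdivlMr.
Qed.

Lemma partial_gaussian_mixture x i :
  partial i G x = \int[m]_y (- s^-1 * (Q *m z x y) i ord0 * k x y).
Proof.
rewrite /partial derive_line -derive1E.
pose f (u : R) y := k (x + u *: delta_mx i ord0) y.
have [M M0 HM] := gaussian_kernel_mulmx_bounded Q.
have D (u : R) y : is_derive u (1 : R) (f^~ y)
    (- s^-1 * (Q *m z (x + u *: delta_mx i ord0) y) i ord0 * f u y).
  have := is_derive_gaussian_kernel1 x y (delta_mx i ord0) u.
  by rewrite precision_form_delta.
(* The interval ]-1, 1[ is an arbitrary neighbourhood of 0: the dominating function is a constant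
   valid for all u, integrable against a probability. *)
have := @differentiation_under_integral R _ _ m f setT measurableT 0 (-1) 1 _ _ _
  (cst (s^-1 * M)).
move=> ->.
- apply: eq_Rintegral => y _; rewrite partial1of2E.
  by rewrite derive_val /f scale0r addr0.
- by rewrite /= in_itv/=; apply/andP; split; lra.
- by move=> u _; exact: integrable_gaussian_kernel.
- by move=> u y _ _; have [] := D u y.
- by move=> y; rewrite mulr_ge0// invr_ge0 ltW.
- exact: finite_measure_integrable_cst.
- move=> u y _ _; rewrite partial1of2E derive_val.
  rewrite normrM (ger0_norm (gaussian_kernel_ge0 _ _)) normrM normrN.
  rewrite (ger0_norm (_ : 0 <= s^-1)) ?invr_ge0 ?(ltW s0)// -mulrA ler_wpM2l//.
    by rewrite invr_ge0 ltW.
Qed.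

End gaussian_kernel.

(** * Conditional expectations from a joint density *)

Section disintegration_condexp.
Context d (T : measurableType d) (R : realType) (P : probability T R).
Context dU (U : measurableType dU) (n p : nat).
Variables (m : {sigma_finite_measure set U -> \bar R}).
Variables (X : T -> U) (Y : T -> 'cV[R]_n) (K : 'cV[R]_n -> U -> R).
Hypotheses (mYX : measurable_fun setT (fun w => (Y w, X w))).
Hypothesis mK : measurable_fun setT (fun p : 'cV[R]_n * U => K p.1 p.2).
Hypothesis K0 : forall x y, 0 <= K x y.
Hypothesis law : forall A, measurable A ->
  (P ((fun w => (Y w, X w)) @^-1` A) =
   \int[lebesgue_measure_cV n \x m]_(p in A) (K p.1 p.2)%:E)%E.

Variable ft : 'cV[R]_n -> R.
Hypotheses (Yft : has_density P Y ft) (ft0 : forall x, 0 < ft x).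

Let mft : measurable_fun setT ft. Proof. by case: Yft. Qed.
Let ft_ge0 x : 0 <= ft x. Proof. exact: ltW. Qed.
Let lawY A : measurable A ->
  (P (Y @^-1` A) = \int[lebesgue_measure_cV n]_(x in A) (ft x)%:E)%E.
Proof. by case: Yft => _ _; exact. Qed.
Let mY : measurable_fun setT Y.
Proof. exact: (measurableT_comp measurable_fst mYX). Qed.

Section scalar.
Variable r : 'cV[R]_n * U -> R.
Hypothesis mr : measurable_fun setT r.
Hypothesis ir : P.-integrable setT (fun w => (r (Y w, X w))%:E).
Hypothesis irK : forall x, m.-integrable setT (fun y => (r (x, y) * K x y)%:E).

Local Notation H := (conditional_moment m K r).

Let iH : (lebesgue_measure_cV n).-integrable setT (EFin \o H).
Proof. exact: (integrable_conditional_moment mYX mK K0 law mr ir irK). Qed.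

Let mH : measurable_fun setT H.
Proof. by apply/measurable_EFinP; exact: (measurable_int _ iH). Qed.

Let ftK x (c : R) : c / ft x * ft x = c.
Proof. by rewrite mulfVK// gt_eqF. Qed.

Lemma measurable_moment_quotient : measurable_fun setT (fun x => H x / ft x).
Proof.
have mV : measurable_fun setT (fun x => (ft x)^-1).
  have -> : (fun x => (ft x)^-1) = (fun x => ft x `^ (-1)).
    by apply/funext => x; rewrite powR_inv1.
  exact: (measurableT_comp (measurable_powR _) mft).
exact: measurable_funM.
Qed.

Lemma integrable_moment_quotient :
  P.-integrable setT (fun w => (H (Y w) / ft (Y w))%:E).
Proof.
apply/(integrable_transfer mY mft ft_ge0 lawY measurable_moment_quotient).
by apply: eq_integrable iH => // x _; rewrite /= ftK.
Qed.

(** Integration against the law of Y restores the factor [ft] and cancels the denominator. *)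
Lemma set_integral_moment_quotient A : measurable A ->
  (\int[P]_(w in Y @^-1` A) (H (Y w) / ft (Y w))%:E =
   \int[P]_(w in Y @^-1` A) (r (Y w, X w))%:E)%E.
Proof.
move=> mA; rewrite (set_integral_conditional_moment mYX mK K0 law mr ir irK)//.
rewrite (set_integral_transfer mY mft ft_ge0 lawY mA
  (f := fun x => (H x / ft x)%:E)).
  by apply: eq_integral => x _; rewrite -EFinM ftK.
by apply/measurable_EFinP; exact: measurable_moment_quotient.
Qed.

(** Both functions have the same Lebesgue integral over every measurable set. With h = r = 1 the
    lemma identifies [ft] itself with the mixture of kernels. *)
Lemma moment_ae_eq (h : 'cV[R]_n -> R) : measurable_fun setT h ->
    P.-integrable setT (fun w => (h (Y w))%:E) ->
    (forall A, measurable A -> \int[P]_(w in Y @^-1` A) (h (Y w))%:E =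
      \int[P]_(w in Y @^-1` A) (r (Y w, X w))%:E)%E ->
  {ae lebesgue_measure_cV n, forall x, h x * ft x = H x}.
Proof.
move=> mh ih hr.
have ihft : (lebesgue_measure_cV n).-integrable setT (fun x => (h x * ft x)%:E).
  exact/(integrable_transfer mY mft ft_ge0 lawY).
have := @integral_ae_eq _ _ _ (lebesgue_measure_cV n) _ measurableT
  (EFin \o H) _ ihft (measurable_int _ iH).
case=> [A _ mA|N [mN N0 HN]].
  rewrite -(set_integral_conditional_moment mYX mK K0 law mr ir irK)// -hr//.
  rewrite (set_integral_transfer mY mft ft_ge0 lawY mA
    (f := fun x => (h x)%:E))//.
  exact/measurable_EFinP.
exists N; split => //; apply: subset_trans HN; apply: subsetC => x /= /(_ I).
by case.
Qed.

End scalar.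

Variable r : 'cV[R]_n * U -> 'cV[R]_p.
Hypothesis mr : measurable_fun setT r.
Hypothesis ir : Lvector P 1 (fun w => r (Y w, X w)).
Hypothesis irK : forall x i,
  m.-integrable setT (fun y => (r (x, y) i ord0 * K x y)%:E).

Definition moment_vector x : 'cV[R]_p :=
  \col_i conditional_moment m K (fun q => r q i ord0) x.

Let mri i : measurable_fun setT (fun q => r q i ord0).
Proof. exact: measurable_fun_coord. Qed.

Let iri i : P.-integrable setT (fun w => (r (Y w, X w) i ord0)%:E).
Proof. exact/Lfun1_integrable/ir. Qed.

(** Existence of a version, by Bayes' formula. *)
Lemma is_condexp_moment_quotient :
  is_condexp P (fun w => r (Y w, X w)) Y (fun x => (ft x)^-1 *: moment_vector x).
Proof.
have E x i : ((ft x)^-1 *: moment_vector x) i ord0 =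
    conditional_moment m K (fun q => r q i ord0) x / ft x.
  by rewrite !mxE mulrC.
split => //.
- apply/measurable_fun_matrixP => i j; rewrite (ord1 j).
  under eq_fun do rewrite E.
  by apply: measurable_moment_quotient => // x; exact: irK.
- move=> i; apply/Lfun1_integrable.
  apply: eq_integrable (integrable_moment_quotient (mri i) (iri i) (irK ^~ i)) => //.
  by move=> w _; rewrite /= E.
- move=> A mA i.
  rewrite -(set_integral_moment_quotient (mri i) (iri i) (irK ^~ i))//.
  by apply: eq_integral => w _; rewrite E.
Qed.

(** Uniqueness up to Lebesgue-null sets; the exceptional sets of the finitely many coordinates are
    merged. *)
Lemma is_condexp_ae_eq h : is_condexp P (fun w => r (Y w, X w)) Y h ->
  {ae lebesgue_measure_cV n, forall x, ft x *: h x = moment_vector x}.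
Proof.
move=> [_ mh ih hr].
have ae_i i : {ae lebesgue_measure_cV n, forall x,
    h x i ord0 * ft x = conditional_moment m K (fun q => r q i ord0) x}.
  apply: moment_ae_eq => //.
  - exact: measurable_fun_coord.
  - exact/Lfun1_integrable/ih.
  - by move=> A mA; exact: hr.
have : {ae lebesgue_measure_cV n, forall x i,
    h x i ord0 * ft x = conditional_moment m K (fun q => r q i ord0) x}.
  exact: filter_forall.
apply: filterS => x hx; apply/matrixP => i j; rewrite (ord1 j) !mxE mulrC.
exact: hx.
Qed.

End disintegration_condexp.

(** * Integrability of Gaussian coordinates, of independent products, and of vectors *)

Lemma has_density_integral1 d (T : measurableType d) (R : realType)
    (P : probability T R) n (X : T -> 'cV[R]_n) f :
  has_density P X f -> (\int[lebesgue_measure_cV n]_x (f x)%:E = 1)%E.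
Proof.
by case=> _ _ /(_ setT measurableT) <-; rewrite preimage_setT probability_setT.
Qed.

(** The bound by exp(-q/4) is a multiple of the Gaussian density at x / sqrt 2. Its integral follows
    by rescaling from total mass 1, which is read off the law of Z, so no Gaussian integral is
    computed. *)
Lemma integrable_normal_coord d (T : measurableType d) (R : realType)
    (P : probability T R) n (C : 'M[R]_n) (Z : {mfun T >-> 'cV[R]_n}) i :
  posdefmx C -> has_density P Z (normal_pdf_cV C) ->
  P.-integrable setT (fun w => (Z w i ord0)%:E).
Proof.
move=> Cpos Zd; have [mg g0 law] := Zd.
apply/(@integrable_transfer _ _ _ _ _ P (lebesgue_measure_cV n) Z _
  (measurable_funPT Z) mg g0 law (fun z => z i ord0)).
  exact: measurable_entry.
(* Chosen so that q(c x, c x) / 2 = q(x, x) / 4. *)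
set c : R := (Num.sqrt 2)^-1.
have c0 : 0 < c by rewrite invr_gt0 sqrtr_gt0.
have c2 : c * c = 2^-1 by rewrite -invfM -expr2 sqr_sqrtr.
pose D := 1 + 4 * C i i.
have mgc : measurable_fun setT (fun x : 'cV[R]_n => normal_pdf_cV C (c *: x)).
  by apply: (measurableT_comp mg); exact: measurable_fun_scalemx.
apply: (@le_integrable _ _ _ (lebesgue_measure_cV n) setT measurableT _
  (fun x => (D * normal_pdf_cV C (c *: x))%:E)).
- by apply/measurable_EFinP; apply: measurable_funM => //; exact: measurable_entry.
- move=> x _; rewrite /= lee_fin normrM (ger0_norm (g0 _)).
  rewrite (le_trans _ (ler_norm _))// !normal_pdf_cVE.
  rewrite precision_formZl precision_formZr// (mulrA c) c2 mulrCA [leRHS]mulrCA.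
  rewrite ler_wpM2l ?invr_ge0 ?sqrtr_ge0//.
  apply: (le_trans (norm_coord_expR_le Cpos i x)).
  rewrite le_eqVlt; apply/orP; left; apply/eqP; congr (_ * expR _).
  by field.
apply/integrableP; split.
  by apply/measurable_EFinP; exact: measurable_funM.
have D0 : 0 <= D by rewrite addr_ge0// mulr_ge0// ltW// posdefmx_diag_gt0.
rewrite (_ : (\int[_]_x _ = D%:E * ((c^-1 ^+ n)%:E *
    \int[lebesgue_measure_cV n]_x (normal_pdf_cV C x)%:E))%E).
  by rewrite (has_density_integral1 Zd) mule1 -EFinM ltry.
rewrite -(ge0_integral_lebesgue_cV_affine 0 c0 (f := fun x => (normal_pdf_cV C x)%:E)).
- rewrite -ge0_integralZl//.
  + apply: eq_integral => x _; rewrite add0r -EFinM gee0_abs//.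
    by rewrite lee_fin mulr_ge0.
  + by under eq_fun do rewrite add0r; exact/measurable_EFinP.
  + by move=> x _; rewrite lee_fin.
- exact/measurable_EFinP.
- by move=> x; rewrite lee_fin.
Qed.

Section distribution_integral.
Context d (T : measurableType d) (R : realType) (P : probability T R).
Context d' (U : measurableType d') (X : {mfun T >-> U}).

Lemma integral_distribution_fin (f : U -> R) : measurable_fun setT f ->
  (\int[P]_w (f (X w))%:E = \int[distribution P X]_y (f y)%:E)%E.
Proof.
move=> mf; rewrite (@integral_transfer _ _ _ _ _ P (distribution P X) X (cst 1)
  (measurable_funPT X) _ _ _ (fun y => (f y)%:E))//.
- by apply: eq_integral => y _; rewrite /= mule1.
- by move=> A mA; rewrite [RHS](@integral_cst _ _ _ _ _ mA 1) mul1e.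
- exact/measurable_EFinP.
Qed.

Lemma integrable_distribution (f : U -> R) : measurable_fun setT f ->
  P.-integrable setT (fun w => (f (X w))%:E) ->
  (distribution P X).-integrable setT (fun y => (f y)%:E).
Proof.
move=> mf /integrableP[_ iX]; apply/integrableP; split.
  exact/measurable_EFinP.
by rewrite -(integral_distribution_fin (f := fun y => `|f y|))//;
  exact: measurableT_comp.
Qed.

End distribution_integral.

Section independent_product.
Context d (T : measurableType d) (R : realType) (P : probability T R).

Lemma integrable_independent_product m n (X : {mfun T >-> 'cV[R]_m})
    (Y : {mfun T >-> 'cV[R]_n}) (f : 'cV[R]_m -> R) (g : 'cV[R]_n -> R) :
    independent_vectors P X Y -> measurable_fun setT f -> measurable_fun setT g ->
    P.-integrable setT (fun w => (f (X w))%:E) ->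
    P.-integrable setT (fun w => (g (Y w))%:E) ->
  P.-integrable setT (fun w => (f (X w) * g (Y w))%:E).
Proof.
move=> XY mf mg /(integrable_distribution mf) /integrableP[_ iX].
move=> /(integrable_distribution mg) /integrableP[_ iY].
have mfg : measurable_fun setT (fun p : 'cV[R]_m * 'cV[R]_n => f p.1 * g p.2).
  apply: measurable_funM; first exact: (measurableT_comp mf).
  exact: (measurableT_comp mg).
have mXY : measurable_fun setT (fun w => (X w, Y w)).
  by apply/measurable_fun_pair; exact: measurable_funPT.
apply/integrableP; split.
  by apply/measurable_EFinP; exact: (measurableT_comp mfg mXY).
have := @ge0_integral_independent _ _ _ P _ _ X Y
  (fun p => `|(f p.1 * g p.2)%:E|%E) XY.
move=> /= -> //; last by apply/measurable_EFinP; exact: measurableT_comp.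
under eq_integral => x _.
  under eq_integral => y _ do rewrite normrM EFinM.
  rewrite ge0_integralZl//.
    over.
  by apply/measurable_EFinP; exact: measurableT_comp.
rewrite ge0_integralZr//.
- apply: lte_mul_pinfty => //; first exact: integral_ge0.
  by rewrite ge0_fin_numE//; exact: integral_ge0.
- by apply/measurable_EFinP; exact: measurableT_comp.
- exact: integral_ge0.
Qed.

End independent_product.

Section vector_integral.
Context d (T : measurableType d) (R : realType).
Variable m : {measure set T -> \bar R}.

Definition vector_integrable n (f : T -> 'cV[R]_n) :=
  forall i, m.-integrable setT (fun y => (f y i ord0)%:E).

(** Entrywise integrals gathered into a vector, so that constant matrices pull out and the final
    computation is matrix algebra. *)
Definition vector_integral n (f : T -> 'cV[R]_n) : 'cV[R]_n :=
  \col_i \int[m]_y (f y i ord0).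

Lemma integrable_sum_fin (I : finType) (h : I -> T -> R) :
  (forall i, m.-integrable setT (fun y => (h i y)%:E)) ->
  m.-integrable setT (fun y => (\sum_i h i y)%:E).
Proof.
move=> ih; under eq_fun do rewrite -sumEFin.
exact: (integrable_sum measurableT _ (fun i _ => ih i)).
Qed.

Lemma Rintegral_sum (I : finType) (h : I -> T -> R) :
  (forall i, m.-integrable setT (fun y => (h i y)%:E)) ->
  \int[m]_y (\sum_i h i y) = \sum_i \int[m]_y h i y.
Proof.
move=> ih; rewrite /Rintegral; under eq_integral do rewrite -sumEFin.
rewrite (integral_sum measurableT ih) (_ : (\sum_i _)%E =
    (\sum_i \int[m]_y h i y)%:E)//.
rewrite -sumEFin; apply: eq_bigr => i _.
by rewrite fineK// integrable_fin_num.
Qed.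

Lemma integrable_mulr_bounded (f g : T -> R) M : measurable_fun setT g ->
    (forall y, `|g y| <= M) -> m.-integrable setT (fun y => (f y)%:E) ->
  m.-integrable setT (fun y => (f y * g y)%:E).
Proof.
move=> mg gM fi; apply: (@le_integrable _ _ _ m setT measurableT _
  (fun y => (M * f y)%:E)).
- apply/measurable_EFinP; apply: measurable_funM => //.
  by apply/measurable_EFinP; exact: (measurable_int _ fi).
- move=> y _; rewrite /= lee_fin !normrM mulrC ler_wpM2r//.
  by rewrite (le_trans (gM y))// ler_norm.
- have := integrableZl measurableT M fi.
  by apply: eq_integrable.
Qed.

Lemma vector_integrable_mulmx n p (A : 'M[R]_(p, n)) f :
  vector_integrable f -> vector_integrable (fun y => A *m f y).
Proof.
move=> fi i; under eq_fun do rewrite mxE; apply: integrable_sum_fin => j.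
by have := integrableZl measurableT (A i j) (fi j); exact: eq_integrable.
Qed.

Lemma vector_integral_mulmx n p (A : 'M[R]_(p, n)) f :
  vector_integrable f ->
  vector_integral (fun y => A *m f y) = A *m vector_integral f.
Proof.
move=> fi; apply/matrixP => i j; rewrite !mxE.
under eq_Rintegral do rewrite mxE.
rewrite Rintegral_sum => [|k].
  by apply: eq_bigr => k _; rewrite mxE RintegralZl//; exact: fi.
by have := integrableZl measurableT (A i k) (fi k); exact: eq_integrable.
Qed.

Lemma vector_integrableZ n (a : R) (f : T -> 'cV[R]_n) :
  vector_integrable f -> vector_integrable (fun y => a *: f y).
Proof.
move=> /(vector_integrable_mulmx a%:M).
by under eq_fun do rewrite mul_scalar_mx.
Qed.

Lemma vector_integralZ n (a : R) (f : T -> 'cV[R]_n) : vector_integrable f ->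
  vector_integral (fun y => a *: f y) = a *: vector_integral f.
Proof.
move=> /(vector_integral_mulmx a%:M).
by under eq_fun do rewrite mul_scalar_mx; rewrite mul_scalar_mx.
Qed.

Lemma vector_integrableB n (f g : T -> 'cV[R]_n) :
  vector_integrable f -> vector_integrable g ->
  vector_integrable (fun y => f y - g y).
Proof.
move=> fi gi i; under eq_fun do rewrite !mxE EFinB.
exact: integrableB.
Qed.

Lemma vector_integralB n (f g : T -> 'cV[R]_n) :
  vector_integrable f -> vector_integrable g ->
  vector_integral (fun y => f y - g y) = vector_integral f - vector_integral g.
Proof.
move=> fi gi; apply/matrixP => i j.
rewrite !mxE -(RintegralB measurableT (fi i) (gi i)).
by apply: eq_Rintegral => y _; rewrite !mxE.
Qed.

Lemma eq_vector_integral n (f g : T -> 'cV[R]_n) : f =1 g ->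
  vector_integral f = vector_integral g.
Proof. by move=> fg; congr vector_integral; exact/funext. Qed.

End vector_integral.

(** * The score of the noisy vector *)

Lemma score_gradient (R : realType) n (f : 'cV[R]_n -> R) x :
  0 < f x -> differentiable f x ->
  score f x = (f x)^-1 *: gradient f x.
Proof.
move=> f0 df; apply/matrixP => i j; rewrite !mxE /partial.
have D : is_derive (f x) 1 (ln (R := R)) (f x)^-1 by exact: is_derive1_ln.
have dl : differentiable (ln (R := R)) (f x).
  by apply/derivable1_diffP; have [] := D.
rewrite -[fun x => ln (f x)]/(ln (R := R) \o f).
rewrite deriveE; last exact: differentiable_comp.
rewrite diff_comp//= deriveE//.
(* The differential of [ln] is linear on R, so its value at a real number is that number times its
   value at 1, which is the derivative. *)
rewrite -[X in 'd _ _ X]mulr1 -[_ * 1]/(_ *: (1 : R)) linearZ /= -deriveE//.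
by rewrite -(deriveE (1 : R) dl) (@derive_val _ _ _ _ _ _ _ D) [_ *: _]mulrC.
Qed.

Section score_of_noisy_vector.
Context {R : realType} {d : nat} {disp : measure_display}.
Context {T : measurableType disp} {P : probability T R}.
Variables (F Z : {mfun T >-> 'cV[R]_d}) (C : 'M[R]_d).
Variable tau : 'cV[R]_d -> 'M[R]_d.
Hypothesis F_L1 : Lvector P 1 F.
Hypothesis Cpos : posdefmx C.
Hypothesis Z_normal : has_density P Z (normal_pdf_cV C).
Hypothesis FZ_indep : independent_vectors P F Z.
Hypothesis tau_Stein : is_Stein_matrix P F tau.
Variables a s : R.
Hypotheses (s0 : 0 < s) (as1 : a ^+ 2 + s ^+ 2 = 1).

Local Notation Q := (invmx C).
Local Notation gam := (normal_pdf_cV C).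
Local Notation m := (distribution P F).
Local Notation k := (noise_kernel gam a s).
Local Notation z := (rescaled_noise a s).
Local Notation G := (gaussian_mixture C a s m).
Local Notation Ft := (fun w => a *: F w + s *: Z w).

Let mtau : measurable_fun setT tau. Proof. by case: tau_Stein. Qed.

Let mk x : measurable_fun setT (k x).
Proof.
exact: (measurableT_comp (measurable_gaussian_kernel C a s) (measurable_pair1 x)).
Qed.

Let mz (x : 'cV[R]_d) : measurable_fun setT (z x).
Proof.
exact: (measurableT_comp (measurable_rescaled_noise a s) (measurable_pair1 x)).
Qed.

Let mF : measurable_fun setT F. Proof. exact: measurable_funPT. Qed.

Let F_int i : P.-integrable setT (fun w => (F w i ord0)%:E).
Proof. exact/Lfun1_integrable/F_L1. Qed.

Let tau_int i j : P.-integrable setT (fun w => (tau (F w) i j)%:E).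
Proof. by case: tau_Stein => _ + _ => /(_ i j) /Lfun1_integrable. Qed.

Let integrable_F_kernel x i :
  P.-integrable setT (fun w => (F w i ord0 * k x (F w))%:E).
Proof.
apply: (integrable_mulr_bounded _ (M := s^-1 ^+ d *
    (Num.sqrt ((2 * pi) ^+ d * \det C))^-1)) => //.
- exact: (measurableT_comp (mk x) mF).
- by move=> w; exact: gaussian_kernel_bounded.
Qed.

(** With [integrable_F_kernel], this makes both sides of Stein's identity well defined for k(x, .):
    each entry is an integrable entry of tau(F) times a bounded factor (Q z)_j k. *)
Let integrable_tau_kernel x i :
  P.-integrable setT
    (fun w => ((tau (F w) *m (Q *m z x (F w))) i ord0 * k x (F w))%:E).
Proof.
have [M M0 HM] := gaussian_kernel_mulmx_bounded a Cpos s0 Q.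
under eq_fun do rewrite mxE mulr_suml.
apply: integrable_sum_fin => j; under eq_fun do rewrite -mulrA.
apply: (integrable_mulr_bounded _ (M := M)) => //.
- apply: measurable_funM; last exact: (measurableT_comp (mk x) mF).
  apply: measurable_fun_coord; apply: measurable_fun_mulmx => //.
  exact: (measurableT_comp (mz x) mF).
- move=> w; rewrite normrM (ger0_norm (gaussian_kernel_ge0 _ _ s0 _ _)).
  exact: HM.
Qed.

Let int_z (x : 'cV[R]_d) : vector_integrable m (fun y => k x y *: z x y).
Proof.
move=> i; have [M M0 HM] := gaussian_kernel_mulmx_bounded a Cpos s0 1%:M.
apply: (@bounded_integrable _ _ _ _ _ M).
  by apply: measurable_fun_coord; exact: measurable_fun_scalemx.
move=> y; have := HM x y i; rewrite mul1mx.
have -> : (k x y *: z x y) i ord0 = z x y i ord0 * k x y.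
  by rewrite [LHS]mxE [LHS]mulrC.
by rewrite normrM (ger0_norm (gaussian_kernel_ge0 _ _ s0 _ _)).
Qed.

Let int_y x : vector_integrable m (fun y => k x y *: y).
Proof.
move=> i; under eq_fun do rewrite mxE mulrC.
apply: integrable_distribution; last exact: integrable_F_kernel.
by apply: measurable_funM => //; exact: measurable_entry.
Qed.

Let int_tau x : vector_integrable m (fun y => k x y *: (tau y *m (Q *m z x y))).
Proof.
move=> i; under eq_fun do rewrite mxE mulrC.
apply: integrable_distribution; last exact: integrable_tau_kernel.
apply: measurable_funM => //; apply: measurable_fun_coord.
by apply: measurable_fun_mulmx => //; exact: measurable_fun_mulmx.
Qed.

Let Stein_kernel x : vector_integral m (fun y => k x y *: y) =
  (a / s) *: vector_integral m (fun y => k x y *: (tau y *m (Q *m z x y))).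
Proof.
have gradk y : gradient (k x) y = (a / s * k x y) *: (Q *m z x y).
  apply/matrixP => i j; rewrite [LHS]mxE [RHS]mxE (ord1 j).
  by rewrite partial_gaussian_kernel2// mulrAC.
have dk y : differentiable (k x) y by exact: differentiable_gaussian_kernel2.
have [_ _ /(_ (k x) dk)] := tau_Stein.
have E1 w i : (k x (F w) *: F w) i ord0 = F w i ord0 * k x (F w).
  by rewrite mxE mulrC.
have E2 w i : (tau (F w) *m gradient (k x) (F w)) i ord0 =
    a / s * ((tau (F w) *m (Q *m z x (F w))) i ord0 * k x (F w)).
  by rewrite gradk -scalemxAr mxE; ring.
move=> St; rewrite -vector_integralZ//; apply/matrixP => i j; rewrite (ord1 j) !mxE.
have {}St := St _ _ i.
rewrite unlock in St.
rewrite /Rintegral; congr fine.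
transitivity (\int[P]_w ((k x (F w) *: F w) i ord0)%:E)%E.
  rewrite (integral_distribution_fin P F (f := fun y => (k x y *: y) i ord0))//.
  by apply: measurable_fun_coord; exact: measurable_fun_scalemx.
rewrite St.
- transitivity (\int[P]_w ((a / s *: (k x (F w) *:
      (tau (F w) *m (Q *m z x (F w))))) i ord0)%:E)%E.
    by apply: eq_integral => w _; rewrite E2 !mxE; congr EFin; ring.
  rewrite (integral_distribution_fin P F (f := fun y =>
    (a / s *: (k x y *: (tau y *m (Q *m z x y)))) i ord0))//.
  apply: measurable_fun_coord; apply: measurable_fun_scalemx => //.
  apply: measurable_fun_scalemx => //.
  by apply: measurable_fun_mulmx => //; exact: measurable_fun_mulmx.
- move=> j'; apply/Lfun1_integrable.
  apply: eq_integrable (integrable_F_kernel x j') => // w _.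
  by rewrite /= E1.
- move=> j'; apply/Lfun1_integrable.
  have := integrableZl measurableT (a / s) (integrable_tau_kernel x j').
  by apply: eq_integrable => // w _; rewrite /= E2.
Qed.

Let V1 x := vector_integral m (fun y => k x y *: z x y).
Let V2 x := vector_integral m (fun y => k x y *: (tau y *m (Q *m z x y))).

(** In the coefficient a^2 / s, one a comes from s z = x - a y and the factor a / s from Stein's
    identity. *)
Let V1E x : s *: V1 x = G x *: x - (a ^+ 2 / s) *: V2 x.
Proof.
rewrite -vector_integralZ//.
have int_x : vector_integrable m (fun y => k x y *: x).
  move=> i; under eq_fun do rewrite mxE mulrC.
  have := integrableZl measurableT (x i ord0)
    (integrable_gaussian_kernel a Cpos s0 m x).
  exact: eq_integrable.
rewrite (eq_vector_integral _ (g := fun y => k x y *: x - a *: (k x y *: y))).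
  rewrite vector_integralB//; last exact: vector_integrableZ.
  rewrite vector_integralZ// Stein_kernel scalerA; congr (_ - _ *: _); last first.
    by ring.
  apply/matrixP => i j; rewrite !mxE (ord1 j).
  under eq_Rintegral do rewrite mxE.
  by rewrite RintegralZr//; exact: integrable_gaussian_kernel.
move=> y; apply/matrixP => i j; rewrite !mxE; field; exact: lt0r_neq0.
Qed.

Let gradientG x : gradient G x = - s^-1 *: (Q *m V1 x).
Proof.
rewrite -vector_integral_mulmx// -vector_integralZ//; last first.
  exact: vector_integrable_mulmx.
apply/matrixP => i j; rewrite [LHS]mxE [RHS]mxE (partial_gaussian_mixture a Cpos s0).
apply: eq_Rintegral => y _; rewrite -(scalemxAr (k x y)).
rewrite [RHS]mxE [X in _ = _ * X]mxE.
by ring.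
Qed.

(** The integral of (I - Q tau(y)) Q z k(x, y): the numerator of the conditional expectation of (I -
    Q tau(F)) Q Z. *)
Let moment x := Q *m V1 x - Q *m V2 x.

(** By [V1E], (a^2 / s) Q V2 - G Q x = - s Q V1, so the left side is -(a^2 / s + s) Q V1; as a^2 +
    s^2 = 1, the coefficient is -1 / s, that of the gradient. *)
Let moment_gradient x : - (a ^+ 2 / s) *: moment x - G x *: (Q *m x) = gradient G x.
Proof.
have s0' : s != 0 by rewrite gt_eqF.
rewrite gradientG /moment scalerBr.
have -> : - (a ^+ 2 / s) *: (Q *m V2 x) = Q *m (s *: V1 x) - G x *: (Q *m x).
  by rewrite V1E mulmxBr -!scalemxAr scaleNr addrAC subrr sub0r.
rewrite opprB addrA addrAC addrK -(scalemxAr s) -scalerBl.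
congr (_ *: _); have : a ^+ 2 = 1 - s ^+ 2 by rewrite -as1 addrK.
by move=> ->; field.
Qed.

Variable ft : 'cV[R]_d -> R.
Hypotheses (Ft_ft : has_density P Ft ft) (ft0 : forall x, 0 < ft x).
Hypothesis ft_smooth : infinitely_differentiable ft.

Let mFtF : measurable_fun setT (fun w => (Ft w, F w)).
Proof.
apply/measurable_fun_pair => //.
by apply: measurable_fun_addmx; apply: measurable_fun_scalemx => //;
  exact: measurable_funPT.
Qed.

Let K0 x y : 0 <= k x y. Proof. exact: gaussian_kernel_ge0. Qed.

Let law := noisy_law a FZ_indep Z_normal s0.

(** The constant 1 is a version of its own conditional expectation, which gives equality almost
    everywhere; continuity of both sides extends it to every point. *)
Let ftE : ft = G.
Proof.
apply/funext; apply: ae_eq_continuous.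
- exact: (ft_smooth 0).
- exact: continuous_gaussian_mixture.
have := @moment_ae_eq _ _ _ P _ _ _ m F Ft k mFtF
  (measurable_gaussian_kernel C a s) K0 law ft Ft_ft ft0 (cst 1) _ _ _ (cst 1).
have E x : conditional_moment m k (cst 1) x = G x.
  by apply: eq_Rintegral => y _; rewrite mul1r.
move=> H; have : {ae lebesgue_measure_cV d, forall x,
    cst 1 x * ft x = conditional_moment m k (cst 1) x}.
  apply: H => //.
  - exact: finite_measure_integrable_cst.
  - move=> x; under eq_fun do rewrite mul1r.
    exact: integrable_gaussian_kernel.
  - exact: finite_measure_integrable_cst.
by apply: filterS => x; rewrite E mul1r.
Qed.

Let ft_score x : score ft x = (ft x)^-1 *: gradient ft x.
Proof. by apply: score_gradient => //; have [] := ft_smooth 1. Qed.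

Variable A : 'M[R]_d.

(** The conditioned vector as a function of (F_t, F): solving x = a y + s z for z recovers Z from
    the pair. *)
Let r (p : 'cV[R]_d * 'cV[R]_d) : 'cV[R]_d :=
  A *m ((1%:M - Q *m tau p.2) *m Q *m z p.1 p.2).

Let mr : measurable_fun setT r.
Proof.
have mtau2 : measurable_fun setT (fun p : 'cV[R]_d * 'cV[R]_d => tau p.2).
  exact: (measurableT_comp mtau).
have mz2 := measurable_rescaled_noise (R := R) (n := d) a s.
apply: measurable_fun_mulmx => //; apply: measurable_fun_mulmx => //.
apply: measurable_fun_mulmx => //; apply: measurable_fun_addmx => //.
by apply: measurable_fun_oppmx; exact: measurable_fun_mulmx.
Qed.

Let zFt w : z (Ft w) (F w) = Z w.
Proof.
rewrite /rescaled_noise [_ + _ - _]addrC addKr scalerA mulVf ?gt_eqF//.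
exact: scale1r.
Qed.

Let rE w : r (Ft w, F w) = A *m ((1%:M - Q *m tau (F w)) *m Q *m Z w).
Proof. by rewrite /r /= zFt. Qed.

Let ir : Lvector P 1 (fun w => r (Ft w, F w)).
Proof.
have ZI j : P.-integrable setT (fun w => (Z w j ord0)%:E).
  exact: (integrable_normal_coord j Cpos Z_normal).
have tauZ : vector_integrable P (fun w => tau (F w) *m (Q *m Z w)).
  move=> i; under eq_fun do rewrite mxE.
  apply: integrable_sum_fin => j; under eq_fun do rewrite [X in _ * X]mxE mulr_sumr.
  apply: integrable_sum_fin => l.
  (* Each term is an integrable entry of tau(F) times an unbounded coordinate of Z; independence
     makes the product integrable. *)
  have := integrableZl measurableT (Q j l) (integrable_independent_product FZ_indep
    (measurable_fun_coord i j mtau) (@measurable_entry _ _ _ _ l ord0)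
    (tau_int i j) (ZI l)).
  by apply: eq_integrable => // w _; rewrite /= -EFinM; congr EFin; ring.
move=> i; apply/Lfun1_integrable.
have := vector_integrable_mulmx A (vector_integrableB
  (vector_integrable_mulmx Q ZI) (vector_integrable_mulmx Q tauZ)) i.
apply: eq_integrable => // w _.
by rewrite /= rE mulmxBl mul1mx mulmxBl !mulmxA.
Qed.

Let rkE x y : k x y *: r (x, y) = A *m (Q *m (k x y *: z x y) -
  Q *m (k x y *: (tau y *m (Q *m z x y)))).
Proof.
rewrite /r /= -!(scalemxAr (k x y)) -scalerBr -(scalemxAr (k x y)).
by rewrite !mulmxBl mul1mx !mulmxA.
Qed.

Let int_rk x : vector_integrable m (fun y => k x y *: r (x, y)).
Proof.
under eq_fun do rewrite rkE.
by apply: vector_integrable_mulmx; apply: vector_integrableB;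
  exact: vector_integrable_mulmx.
Qed.

Let irK x i : m.-integrable setT (fun y => (r (x, y) i ord0 * k x y)%:E).
Proof.
by have := int_rk x i; under eq_fun do rewrite mxE mulrC.
Qed.

Let moment_vectorE x : moment_vector m k r x = A *m moment x.
Proof.
rewrite /moment -vector_integral_mulmx// -[Q *m V2 x]vector_integral_mulmx//.
rewrite -vector_integralB; try exact: vector_integrable_mulmx.
rewrite -vector_integral_mulmx; last first.
  by apply: vector_integrableB; exact: vector_integrable_mulmx.
apply/matrixP => i j; rewrite [LHS]mxE [RHS]mxE; apply: eq_Rintegral => y _.
by rewrite -rkE [RHS]mxE [RHS]mulrC.
Qed.

Let scoreE x h : ft x *: h = A *m moment x ->
  - (a ^+ 2 / s) *: h - A *m Q *m x = A *m score ft x.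
Proof.
move=> hx; have ftx : ft x != 0 by rewrite gt_eqF.
have -> : h = (ft x)^-1 *: (A *m moment x).
  by rewrite -hx scalerA mulVf// scale1r.
have -> : score ft x = (ft x)^-1 *: (- (a ^+ 2 / s) *: moment x - ft x *: (Q *m x)).
  by rewrite ft_score; congr (_ *: _); rewrite ftE moment_gradient.
clear hx; move: (moment x) => M; rewrite -scalemxAr mulmxBr -!scalemxAr.
by rewrite scalerBr !scalerA mulVf// scale1r mulmxA [_^-1 * _]mulrC.
Qed.

Lemma condexp_score (YA : T -> 'cV[R]_d) :
    (forall w, YA w = A *m ((1%:M - Q *m tau (F w)) *m Q *m Z w)) ->
  (exists h, is_condexp P YA Ft h) /\
  forall h, is_condexp P YA Ft h ->
    {ae lebesgue_measure_cV d, forall x,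
      - (a ^+ 2 / s) *: h x - A *m Q *m x = A *m score ft x}.
Proof.
move=> YAE; have -> : YA = (fun w => r (Ft w, F w)).
  by apply/funext => w; rewrite YAE rE.
split.
  eexists; exact: (is_condexp_moment_quotient mFtF
    (measurable_gaussian_kernel C a s) K0 law Ft_ft ft0 mr ir irK).
move=> h /(is_condexp_ae_eq mFtF
  (measurable_gaussian_kernel C a s) K0 law Ft_ft ft0 mr ir irK).
by apply: filterS => x; rewrite moment_vectorE => /scoreE.
Qed.

End score_of_noisy_vector.

Theorem lemma2p9 (R : realType) (d : nat) (hd : (1 <= d)%N)
  (disp : measure_display) (T : measurableType disp) (P : probability T R)
  (F Z : {RV P >-> 'cV[R]_d}) (B C : 'M[R]_d)
  (tau : 'cV[R]_d -> 'M[R]_d)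
  (F_L2 : Lvector P 2%:E F)
  (F_centered : forall i, ('E_P[fun w => F w i ord0] = 0)%E)
  (F_density : exists f, has_density P F f)
  (F_cov : is_covariance_matrix P F B)
  (B_posdef : posdefmx B)
  (C_posdef : posdefmx C)
  (Z_normal : has_density P Z (normal_pdf_cV C))
  (FZ_indep : independent_vectors P F Z)
  (tau_Stein : is_Stein_matrix P F tau)
  (t : R) (t_range : 0 <= t < 1) :
  let Ft := fun w => Num.sqrt t *: F w + Num.sqrt (1 - t) *: Z w in
  let Gamma := t *: B + (1 - t) *: C in
  let Y := fun w =>
    (1%:M - invmx C *m tau (F w)) *m invmx C *m Z w in
  let Ystar := fun w =>
    (Gamma - Gamma *m invmx C *m tau (F w)) *m invmx C *m Z w in
  forall ft : 'cV[R]_d -> R,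
    has_density P Ft ft ->
    (forall x, 0 < ft x) ->
    infinitely_differentiable ft ->
  ((exists h, is_condexp P Y Ft h) /\
   forall h, is_condexp P Y Ft h ->
     {ae lebesgue_measure_cV d, forall x,
       - (t / Num.sqrt (1 - t)) *: h x - invmx C *m x = score ft x}) /\
  ((exists h, is_condexp P Ystar Ft h) /\
   forall h, is_condexp P Ystar Ft h ->
     {ae lebesgue_measure_cV d, forall x,
       - (t / Num.sqrt (1 - t)) *: h x - Gamma *m invmx C *m x =
       Gamma *m score ft x}).
Proof.
move=> Ft Gamma Y Ystar ft Ft_ft ft0 ft_smooth.
have /andP[t0 t1] := t_range.
have s0 : 0 < Num.sqrt (1 - t) by rewrite sqrtr_gt0 subr_gt0.
have a2 : Num.sqrt t ^+ 2 = t by rewrite sqr_sqrtr.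
have as1 : Num.sqrt t ^+ 2 + Num.sqrt (1 - t) ^+ 2 = 1.
  by rewrite a2 sqr_sqrtr ?subr_ge0 ?(ltW t1)// addrC subrK.
have F_L1 : Lvector P 1 F.
  by move=> i; apply: Lfun_subset12 (F_L2 i); exact: fin_num_measure.
have main A := @condexp_score R d disp T P F Z C tau F_L1 C_posdef Z_normal
  FZ_indep tau_Stein _ _ s0 as1 ft Ft_ft ft0 ft_smooth A.
rewrite a2 in main; split.
  have [w|ex ae] := main 1%:M Y; first by rewrite /Y mul1mx.
  by split=> // h /ae; apply: filterS => x; rewrite !mul1mx.
(* The case A = Gamma, since Gamma - Gamma Q tau = Gamma (I - Q tau). *)
by apply: main => w; rewrite /Ystar !mulmxA mulmxBr mulmx1 mulmxA.
Qed.
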